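(* Let $A$ be a gentle $K$-algebra, let $TA=A\ltimes DA$ be its trivial extension, and let $B$ be the Brauer graph algebra isomorphic to $TA$. Suppose $\operatorname{char} K\neq 2$. Then: (1) the Lie algebra $HH^1(A)$ is solvable if and only if $A$ is not the Kronecker algebra; (2) the Lie algebra $HH^1(B)$ is solvable if and only if $B$ is not isomorphic to the trivial extension of the Kronecker algebra.
   Context: $K$ is a field; all algebras are finite dimensional and indecomposable. Paths in a quiver are composed right to left ($ba$ means first $a$, then $b$); $s,t$ denote source and target. A gentle algebra is $A=KQ/I$ (finite dimensional), with $Q$ a finite connected quiver, such that: (1) at each vertex at most two arrows end and at most two arrows start; (2) for every arrow $a$ there is at most one arrow $b$ with $s(a)=t(b)$ and $ab\notin I$, and at most one arrow $c$ with $s(c)=t(a)$ and $ca\notin I$; (3) for every arrow $a$ there is at most one arrow $b$ with $s(a)=t(b)$ and $ab\in I$, and at most one arrow $c$ with $s(c)=t(a)$ and $ca\in I$; (4) $I$ is generated by paths of length $2$. Standing assumption: $A$ is neither $K$ (one vertex, no arrow) nor $K[x]/(x^2)$ (one vertex, one loop). $DA=\operatorname{Hom}_K(A,K)$ with its usual $A$-bimodule structure, and $TA=A\ltimes DA$ is the trivial extension, i.e. $A\oplus DA$ with product $(a,f)(b,g)=(ab,ag+fb)$. Trivial extensions of gentle algebras are exactly the Brauer graph algebras with all multiplicities equal to $1$. $HH^1(C)$ is the space of $K$-derivations of $C$ modulo inner derivations, with the Lie bracket induced by the commutator. The Kronecker algebra is the path algebra of the quiver with two vertices $e_1,e_2$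 and two parallel arrows from $e_1$ to $e_2$. *)

(* Defs.v *)
From HB Require Import structures.
From mathcomp Require Import all_boot all_order all_algebra all_fingroup.
From mathcomp Require Import all_field.
From mathcomp Require Import finmap boolp.
From mathcomp Require Import monalg.

Set Implicit Arguments.
Unset Strict Implicit.
Unset Printing Implicit Defensive.

Import GRing.Theory.

Local Open Scope ring_scope.

Section Algebras.

Variable K : fieldType.

Definition alg_iso (A B : algType K) : Prop :=
  exists f : {lrmorphism A -> B}, bijective f.

Definition two_sided_ideal (C : algType K) (I : C -> Prop) : Prop :=
  [/\ I 0,
      forall x y, I x -> I y -> I (x + y),
      forall c x, I x -> I (c * x)
    & forall c x, I x -> I (x * c)].

Definition ideal_gen (C : algType K) (S : C -> Prop) (x : C) : Prop :=
  forall I : C -> Prop,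
    two_sided_ideal I -> (forall y, S y -> I y) -> I x.

(* For a two-sided ideal I: the algebra A is (isomorphic to) C / I. *)
Definition is_quotient (C A : algType K) (I : C -> Prop) : Prop :=
  exists f : {lrmorphism C -> A},
    (forall y, exists x, f x = y) /\ (forall x, f x = 0 <-> I x).

End Algebras.

Record quiver := Quiver {
  vertex : finType;
  arrow : finType;
  source : arrow -> vertex;
  target : arrow -> vertex;
  _ : (0 < #|vertex|)%N
}.

Definition quiver_connected (Q : quiver) : Prop :=
  forall u v : vertex Q,
    connect [rel x y | [exists a : arrow Q,
      ((source a == x) && (target a == y)) ||
      ((source a == y) && (target a == x))]] u v.

Section Paths.

Variable Q : quiver.

Fixpoint is_walk (v : vertex Q) (s : seq (arrow Q)) : bool :=
  if s is a :: s' then (source a == v) && is_walk (target a) s' else true.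

(* A path is its source together with the list of its arrows, in the order in *)
(* which they are traversed; the path written a_n ... a_1 has list            *)
(* [:: a_1; ...; a_n], and (v, [::]) is the trivial path e_v.                 *)
Record qpath := QPath {
  qpath_val : vertex Q * seq (arrow Q);
  _ : is_walk qpath_val.1 qpath_val.2
}.

HB.instance Definition _ := [isSub for qpath_val].
HB.instance Definition _ := [Choice of qpath by <:].

Definition psource (p : qpath) : vertex Q := (val p).1.
Definition parrows (p : qpath) : seq (arrow Q) := (val p).2.
Definition ptarget (p : qpath) : vertex Q :=
  last (psource p) [seq target a | a <- parrows p].

Definition trivial_path (v : vertex Q) : qpath := @QPath (v, [::]) isT.

Lemma is_walk_arrow (a : arrow Q) : is_walk (source a) [:: a].
Proof. by rewrite /= eqxx. Qed.

Definition arrow_path (a : arrow Q) : qpath :=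
  @QPath (source a, [:: a]) (is_walk_arrow a).

(* The composite q p, first p and then q; the test ptarget p == psource q is  *)
(* needed on top of insub when q is a trivial path.                           *)
Definition pcomp (q p : qpath) : option qpath :=
  if ptarget p == psource q
  then insub (psource p, parrows p ++ parrows q) else None.

Lemma is_walk_cat v s1 s2 :
  is_walk v (s1 ++ s2) =
  is_walk v s1 && is_walk (last v [seq target a | a <- s1]) s2.
Proof. by elim: s1 v => //= a s1 IH v; rewrite IH andbA. Qed.

Lemma pcomp_someP (q p r : qpath) :
  pcomp q p = Some r <->
  ptarget p = psource q /\ val r = (psource p, parrows p ++ parrows q).
Proof.
rewrite /pcomp; case: eqP => [e|ne]; last by split=> // -[].
case: insubP => [r' _ <-|].
  by split=> [[->]|[_ /val_inj->]].
rewrite /= is_walk_cat (valP p) /= -/(ptarget p) e.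
by rewrite (valP q).
Qed.

Lemma pcomp_none (q p : qpath) : ptarget p <> psource q -> pcomp q p = None.
Proof. by rewrite /pcomp; case: eqP. Qed.

Lemma pcomp_ex (q p : qpath) : ptarget p = psource q ->
  exists r, pcomp q p = Some r.
Proof.
move=> e; have w : is_walk (psource p) (parrows p ++ parrows q).
  by rewrite is_walk_cat (valP p) -/(ptarget p) e (valP q).
by exists (@QPath (_, _) w); apply/pcomp_someP.
Qed.

Lemma pcomp_st (q p r : qpath) : pcomp q p = Some r ->
  psource r = psource p /\ ptarget r = ptarget q.
Proof.
case/pcomp_someP=> e er; split; first by rewrite /psource er.
by rewrite {1}/ptarget /psource {1}/parrows er /= map_cat last_cat -/(ptarget p) e.
Qed.

Lemma pcompA (r q p : qpath) :
  obind (fun s => pcomp r s) (pcomp q p) =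
  obind (fun s => pcomp s p) (pcomp r q).
Proof.
case: (eqVneq (ptarget p) (psource q)) => [e1|/eqP ne1]; last first.
  rewrite (pcomp_none ne1) /=; case E: (pcomp r q) => [s|] //=.
  by rewrite pcomp_none //; case: (pcomp_st E) => -> _.
have [s Es] := pcomp_ex e1; rewrite Es /=; have [ss st] := pcomp_st Es.
case: (eqVneq (ptarget q) (psource r)) => [e2|/eqP ne2]; last first.
  by rewrite (pcomp_none ne2) pcomp_none // st.
have [u Eu] := pcomp_ex e2; rewrite Eu /=; have [us ut] := pcomp_st Eu.
have [x Ex] : exists x, pcomp r s = Some x by apply: pcomp_ex; rewrite st.
rewrite Ex; symmetry; apply/pcomp_someP; rewrite us; split=> //.
case/pcomp_someP: Ex => _ ->; rewrite ss /parrows.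
case/pcomp_someP: Es => _ ->; case/pcomp_someP: Eu => _ -> /=.
by rewrite catA.
Qed.

Lemma pcomp_id_r (p : qpath) (v : vertex Q) :
  pcomp p (trivial_path v) = if v == psource p then Some p else None.
Proof.
case: eqVneq => [->|/eqP ne]; last by rewrite pcomp_none.
by apply/pcomp_someP; split=> //; rewrite /psource /parrows /=; case: (val p).
Qed.

Lemma pcomp_id_l (p : qpath) (v : vertex Q) :
  pcomp (trivial_path v) p = if v == ptarget p then Some p else None.
Proof.
case: eqVneq => [->|/eqP ne]; last by rewrite pcomp_none //; apply/nesym.
apply/pcomp_someP; split=> //; rewrite /psource /parrows /= cats0.
by case: (val p).
Qed.

End Paths.

Section PathAlgebra.

Variables (K : fieldType) (Q : quiver).

Definition path_algebra : Type := {malg K[qpath Q]}.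

HB.instance Definition _ := Choice.on path_algebra.

(* The module operations are those of {malg K[qpath Q]}, locked: their        *)
(* unfolding makes failing unifications prohibitively slow.                   *)
Fact path_key : unit. Proof. by []. Qed.
Definition pzero : path_algebra :=
  locked_with path_key (0 : {malg K[qpath Q]}).
Definition popp : path_algebra -> path_algebra :=
  locked_with path_key (fun x : {malg K[qpath Q]} => - x).
Definition padd : path_algebra -> path_algebra -> path_algebra :=
  locked_with path_key (fun x y : {malg K[qpath Q]} => x + y).
Definition pscale : K -> path_algebra -> path_algebra :=
  locked_with path_key (fun c (x : {malg K[qpath Q]}) => c *: x).
Definition pbasis : qpath Q -> path_algebra :=
  locked_with path_key (fun p => << p >> : {malg K[qpath Q]}).

Fact paddA : associative padd.
Proof. by rewrite /padd unlock; apply: addrA. Qed.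
Fact paddC : commutative padd.
Proof. by rewrite /padd unlock; apply: addrC. Qed.
Fact padd0x : left_id pzero padd.
Proof. by rewrite /padd /pzero !unlock; apply: add0r. Qed.
Fact paddNx : left_inverse pzero popp padd.
Proof. by rewrite /padd /pzero /popp !unlock; apply: addNr. Qed.

HB.instance Definition _ :=
  GRing.isZmodule.Build path_algebra paddA paddC padd0x paddNx.

Fact pscaleA a b v : pscale a (pscale b v) = pscale (a * b) v.
Proof. by rewrite /pscale unlock; apply: scalerA. Qed.
Fact pscale1x : left_id 1 pscale.
Proof. by rewrite /pscale unlock; apply: scale1r. Qed.
Fact pscaleDr : right_distributive pscale +%R.
Proof.
by move=> c x y; rewrite -[LHS]/(pscale c (padd x y))
  -[RHS]/(padd (pscale c x) (pscale c y)) /pscale /padd !unlock; apply: scalerDr.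
Qed.
Fact pscaleDl v : {morph pscale^~ v : a b / a + b}.
Proof.
by move=> a b; rewrite -[RHS]/(padd (pscale a v) (pscale b v))
  /pscale /padd !unlock; apply: scalerDl.
Qed.

HB.instance Definition _ := GRing.Zmodule_isLmodule.Build K path_algebra
  pscaleA pscale1x pscaleDr pscaleDl.

Definition pcoef (p : qpath Q) (x : path_algebra) : K :=
  mcoeff p (x : {malg K[qpath Q]}).
Definition psupp (x : path_algebra) : {fset qpath Q} :=
  msupp (x : {malg K[qpath Q]}).

Lemma pcoefP (x y : path_algebra) : (forall p, pcoef p x = pcoef p y) -> x = y.
Proof. by move/malgP. Qed.

Lemma pcoef_linear p : linear_for *%R (pcoef p).
Proof.
move=> c x y; rewrite -[c *: x + y]/(padd (pscale c x) y) /padd /pscale !unlock.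
by rewrite /pcoef mcoeffD mcoeffZ.
Qed.

HB.instance Definition _ p :=
  GRing.isLinear.Build K path_algebra K _ (pcoef p) (pcoef_linear p).

Lemma pcoef_basis p q : pcoef q (pbasis p) = (p == q)%:R.
Proof. by rewrite /pbasis unlock /pcoef mcoeffU. Qed.

Lemma psuppP p x : (p \in psupp x) = (pcoef p x != 0).
Proof. by rewrite /psupp -mcoeff_neq0. Qed.

Lemma psupp_basis p : psupp (pbasis p) = [fset p]%fset.
Proof. by rewrite /pbasis unlock /psupp msuppU oner_eq0. Qed.

Definition pbasis_opt (p : option (qpath Q)) : path_algebra :=
  oapp pbasis 0 p.

Definition linext (M : lmodType K) (h : qpath Q -> M) (x : path_algebra) : M :=
  \sum_(p <- psupp x) pcoef p x *: h p.

Definition path_mul (x y : path_algebra) : path_algebra :=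
  linext (fun q => linext (fun p => pbasis_opt (pcomp q p)) y) x.

Definition path_one : path_algebra := \sum_(v : vertex Q) pbasis (trivial_path v).

Lemma linextw (M : lmodType K) (h : qpath Q -> M) (x : path_algebra)
    (d : {fset qpath Q}) : (psupp x `<=` d)%fset ->
  linext h x = \sum_(p <- d) pcoef p x *: h p.
Proof.
move=> sxd; rewrite /linext; apply: big_fset_incl => // p _.
by rewrite psuppP negbK => /eqP->; rewrite scale0r.
Qed.

Lemma linext_linear (M : lmodType K) (h : qpath Q -> M) : linear (linext h).
Proof.
move=> c x y; pose d := (psupp x `|` psupp y)%fset.
have sx : (psupp x `<=` d)%fset by apply: fsubsetUl.
have sy : (psupp y `<=` d)%fset by apply: fsubsetUr.
have sc : (psupp (c *: x + y)%R `<=` d)%fset.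
  apply/fsubsetP=> p; rewrite inE !psuppP linearP /=; apply: contraNT.
  by rewrite negb_or !negbK => /andP[/eqP-> /eqP->]; rewrite mulr0 addr0.
rewrite (linextw _ sx) (linextw _ sy) (linextw _ sc) scaler_sumr -big_split /=.
by apply: eq_bigr => p _; rewrite linearP /= scalerDl scalerA.
Qed.

HB.instance Definition _ (M : lmodType K) (h : qpath Q -> M) :=
  GRing.isLinear.Build K path_algebra M _ (linext h) (linext_linear h).

Lemma linext_basis (M : lmodType K) (h : qpath Q -> M) p :
  linext h (pbasis p) = h p.
Proof. by rewrite /linext psupp_basis big_seq_fset1 pcoef_basis eqxx scale1r. Qed.

Lemma path_algebraE (x : path_algebra) :
  x = \sum_(p <- psupp x) pcoef p x *: pbasis p.
Proof.
apply: pcoefP => q; rewrite linear_sum /=.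
have [xq|] := boolP (q \in psupp x); last first.
  move=> xq; have := xq; rewrite psuppP negbK => /eqP->.
  rewrite big_seq big1 // => p xp; rewrite linearZ /= pcoef_basis.
  by case: eqVneq xp xq => [->->|]; rewrite ?mulr0.
rewrite (bigD1_seq q) ?fset_uniq //= linearZ /= pcoef_basis eqxx mulr1.
by rewrite big1 ?addr0 // => p /negbTE npq; rewrite linearZ /= pcoef_basis npq mulr0.
Qed.

Lemma path_algebra_ind (P : path_algebra -> Prop) :
  P 0 -> (forall c x y, P x -> P y -> P (c *: x + y)) ->
  (forall p, P (pbasis p)) -> forall x, P x.
Proof.
move=> P0 PD Pb x; rewrite (path_algebraE x).
elim: (enum_fset _) => [|p s IH]; first by rewrite big_nil.
by rewrite big_cons; apply: PD.
Qed.

Lemma path_mulDl c x y z :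
  path_mul (c *: x + y) z = c *: path_mul x z + path_mul y z.
Proof. exact: linext_linear. Qed.

Lemma path_mulDr c x y z :
  path_mul x (c *: y + z) = c *: path_mul x y + path_mul x z.
Proof.
rewrite /path_mul /linext scaler_sumr -big_split /=.
apply: eq_bigr => q _; rewrite -!/(linext _ _) linearP /= scalerDr !scalerA.
by rewrite mulrC.
Qed.

Lemma path_mul0x x : path_mul 0 x = 0.
Proof. exact: linear0. Qed.

Lemma path_mulx0 x : path_mul x 0 = 0.
Proof. by have := path_mulDr (-1) x 0 0; rewrite scaler0 addr0 scaleN1r addNr. Qed.

Lemma path_mul_basis q p :
  path_mul (pbasis q) (pbasis p) = pbasis_opt (pcomp q p).
Proof. by rewrite /path_mul !linext_basis. Qed.

Lemma path_lin_eq (M : lmodType K) (f g : path_algebra -> M) :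
  linear f -> linear g -> (forall p, f (pbasis p) = g (pbasis p)) -> f =1 g.
Proof.
move=> lf lg e; apply: path_algebra_ind => [|c x y ex ey|p] //.
  have f0 h : linear h -> h 0 = 0 :> M.
    by move=> lh; have := lh (-1) 0 0; rewrite scaler0 addr0 scaleN1r addNr.
  by rewrite !f0.
by rewrite lf lg ex ey.
Qed.

Lemma path_bilin_assoc (m : path_algebra -> path_algebra -> path_algebra) :
  (forall c x y z, m (c *: x + y) z = c *: m x z + m y z) ->
  (forall c x y z, m x (c *: y + z) = c *: m x y + m x z) ->
  (forall r q p, m (pbasis r) (m (pbasis q) (pbasis p)) =
                 m (m (pbasis r) (pbasis q)) (pbasis p)) ->
  associative m.
Proof.
move=> mDl mDr e x y z.
apply: (@path_lin_eq _ (fun x => m x (m y z)) (fun x => m (m x y) z))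
  => [c u v|c u v|r]; rewrite ?mDl //.
apply: (@path_lin_eq _ (fun y => m (pbasis r) (m y z))
          (fun y => m (m (pbasis r) y) z)) => [c u v|c u v|q];
  rewrite ?(mDl, mDr) //.
by apply: (@path_lin_eq _ (fun z => m (pbasis r) (m (pbasis q) z))
          (fun z => m (m (pbasis r) (pbasis q)) z))
          => [c u v|c u v|p]; rewrite ?(mDl, mDr).
Qed.

Lemma path_mulA : associative path_mul.
Proof.
apply: path_bilin_assoc path_mulDl path_mulDr _ => r q p.
rewrite (path_mul_basis q p) (path_mul_basis r q).
have -> : path_mul (pbasis r) (pbasis_opt (pcomp q p)) =
          pbasis_opt (obind (fun s => pcomp r s) (pcomp q p)).
  by case: (pcomp q p) => [s|]; [exact: path_mul_basis|exact: path_mulx0].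
have -> : path_mul (pbasis_opt (pcomp r q)) (pbasis p) =
          pbasis_opt (obind (fun s => pcomp s p) (pcomp r q)).
  by case: (pcomp r q) => [s|]; [exact: path_mul_basis|exact: path_mul0x].
by rewrite pcompA.
Qed.

Lemma path_mul1x : left_id path_one path_mul.
Proof.
apply: path_lin_eq => // [c u v|p]; first exact: path_mulDr.
rewrite /path_one /path_mul linear_sum /= (bigD1 (ptarget p)) //=.
rewrite !linext_basis pcomp_id_l eqxx /= big1 ?addr0 // => v /negbTE nv.
by rewrite !linext_basis pcomp_id_l nv.
Qed.

Lemma path_mulx1 : right_id path_one path_mul.
Proof.
apply: path_lin_eq => // [c u v|p]; first exact: path_mulDl.
rewrite /path_one /path_mul linext_basis linear_sum /= (bigD1 (psource p)) //=.
rewrite linext_basis pcomp_id_r eqxx /= big1 ?addr0 // => v /negbTE nv.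
by rewrite linext_basis pcomp_id_r nv.
Qed.

Lemma path_mulDl1 : left_distributive path_mul +%R.
Proof. by move=> x y z; have := path_mulDl 1 x y z; rewrite !scale1r. Qed.

Lemma path_mulDr1 : right_distributive path_mul +%R.
Proof. by move=> x y z; have := path_mulDr 1 x y z; rewrite !scale1r. Qed.

Lemma path_one_neq0 : path_one != 0.
Proof.
have /card_gt0P[v _] : (0 < #|vertex Q|)%N by case: (Q).
apply/eqP=> /(congr1 (pcoef (trivial_path v))) /eqP.
rewrite linear0 linear_sum /= (bigD1 v) //= pcoef_basis eqxx.
rewrite big1 ?addr0 ?oner_eq0 // => u nu; rewrite pcoef_basis.
by rewrite (_ : (_ == _) = false) //; apply/negbTE; apply: contraNneq nu => -[->].
Qed.

HB.instance Definition _ := GRing.Zmodule_isNzRing.Build path_algebra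
  path_mulA path_mul1x path_mulx1 path_mulDl1 path_mulDr1 path_one_neq0.

Lemma path_scaleAl (c : K) (x y : path_algebra) : c *: (x * y) = (c *: x) * y.
Proof.
by have := path_mulDl c x 0 y; rewrite path_mul0x !addr0.
Qed.

HB.instance Definition _ :=
  GRing.Lmodule_isLalgebra.Build K path_algebra path_scaleAl.

Lemma path_scaleAr (c : K) (x y : path_algebra) : c *: (x * y) = x * (c *: y).
Proof.
by have := path_mulDr c x y 0; rewrite path_mulx0 !addr0.
Qed.

HB.instance Definition _ :=
  GRing.Lalgebra_isAlgebra.Build K path_algebra path_scaleAr.

Definition arr (a : arrow Q) : path_algebra := pbasis (arrow_path a).

(* The product a_n ... a_1 for s = [:: a_1; ...; a_n]. *)
Definition arrs (s : seq (arrow Q)) : path_algebra :=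
  \prod_(a <- rev s) arr a.

End PathAlgebra.

Section Gentle.

Variable K : fieldType.

Record gentle_ideal (Q : quiver) (I : path_algebra K Q -> Prop) : Prop := {
  gentle_in : forall v, (#|[set a : arrow Q | target a == v]| <= 2)%N;
  gentle_out : forall v, (#|[set a : arrow Q | source a == v]| <= 2)%N;
  gentle_nonrel_before : forall a b b' : arrow Q,
    source a = target b -> ~ I (arr K a * arr K b) ->
    source a = target b' -> ~ I (arr K a * arr K b') -> b = b';
  gentle_nonrel_after : forall a c c' : arrow Q,
    source c = target a -> ~ I (arr K c * arr K a) ->
    source c' = target a -> ~ I (arr K c' * arr K a) -> c = c';
  gentle_rel_before : forall a b b' : arrow Q,
    source a = target b -> I (arr K a * arr K b) ->
    source a = target b' -> I (arr K a * arr K b') -> b = b';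
  gentle_rel_after : forall a c c' : arrow Q,
    source c = target a -> I (arr K c * arr K a) ->
    source c' = target a -> I (arr K c' * arr K a) -> c = c';
  gentle_quadratic : exists R : arrow Q -> arrow Q -> Prop,
    (forall b a, R b a -> source b = target a) /\
    (forall x, I x <->
       ideal_gen (fun y => exists b a, R b a /\ y = arr K b * arr K a) x)
}.

(* Finite dimensionality is part of the type falgType K. *)
Definition gentle (A : falgType K) : Prop :=
  exists (Q : quiver) (I : path_algebra K Q -> Prop),
    [/\ quiver_connected Q, gentle_ideal I & is_quotient A I].

End Gentle.

(* A Brauer graph with set of edges E, given by its half-edges E * bool: the  *)
(* half-edges of e are (e, true) and (e, false), the vertices of the graph    *)
(* are the cycles of the permutation bg_next, which is the cyclic ordering of *)
(* the half-edges around each vertex, and bg_mult h is the multiplicity of    *)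
(* the vertex at which h is attached.                                         *)
Record brauer_graph := BrauerGraph {
  bg_edge : finType;
  bg_next : {perm bg_edge * bool};
  bg_mult : bg_edge * bool -> nat;
  bg_nonempty : (0 < #|bg_edge|)%N;
  bg_mult_gt0 : forall h, (0 < bg_mult h)%N;
  bg_mult_next : forall h, bg_mult (bg_next h) = bg_mult h;
  bg_connected : forall h k,
    connect [rel x y | (y == bg_next x) || (y.1 == x.1)] h k
}.

Section BrauerGraphAlgebra.

Variable G : brauer_graph.

Local Notation half := (bg_edge G * bool)%type.

Definition bg_quiver : quiver :=
  @Quiver (bg_edge G) half fst (fun h => (bg_next G h).1) (bg_nonempty G).

(* The list of arrows of the m-th power of the cycle C_h around the vertex of *)
(* h, starting at h.                                                          *)
Definition bg_cycle (h : half) : seq half :=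
  traject (bg_next G) h (#|porbit (bg_next G) h| * bg_mult h)%N.

(* Truncated half-edges (valency and multiplicity 1) keep their arrow, a loop *)
(* alpha_h = C_h, which bg_cycle_eq then eliminates; in this presentation the *)
(* relations need no case distinction.                                        *)
Inductive bg_relation (K : fieldType) : path_algebra K bg_quiver -> Prop :=
| bg_cycle_eq (e : bg_edge G) :
    bg_relation (@arrs K bg_quiver (bg_cycle (e, true))
                 - @arrs K bg_quiver (bg_cycle (e, false)))
| bg_cycle_long (h : half) :
    bg_relation (@arrs K bg_quiver (rcons (bg_cycle h) h))
| bg_zero (h k : half) :
    (bg_next G h).1 = k.1 -> bg_next G h <> k ->
    bg_relation (@arrs K bg_quiver [:: h; k]).

End BrauerGraphAlgebra.

Definition brauer_graph_algebra (K : fieldType) (B : algType K) : Prop :=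
  exists G : brauer_graph, is_quotient B (ideal_gen (@bg_relation G K)).

Section TrivialExtension.

Variables (K : fieldType) (A : falgType K).

Local Notation dual := 'Hom(A, K^o).

(* (a f) x = f (x a) and (f b) x = f (b x) *)
Definition dual_lact (a : A) (f : dual) : dual := (f \o amulr a)%VF.
Definition dual_ract (f : dual) (b : A) : dual := (f \o amull b)%VF.

Lemma dual_lactE a f x : dual_lact a f x = f (x * a).
Proof. by rewrite /dual_lact !lfunE /= lfunE. Qed.

Lemma dual_ractE f b x : dual_ract f b x = f (b * x).
Proof. by rewrite /dual_ract !lfunE /= lfunE. Qed.

Definition trivext : Type := (A * dual)%type.
HB.instance Definition _ := Vector.copy trivext (A * dual)%type.

Definition trivext_mul (x y : trivext) : trivext :=
  (x.1 * y.1, dual_lact x.1 y.2 + dual_ract x.2 y.1).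

Definition trivext_one : trivext := (1, 0).

Let lE := (dual_lactE, dual_ractE, add_lfunE, scale_lfunE, zero_lfunE).

Lemma trivext_mulA : associative trivext_mul.
Proof.
move=> [a f] [b g] [c h]; congr (_, _) => /=; first by rewrite mulrA.
by apply/lfunP=> x; rewrite !lE /= !mulrA addrA.
Qed.

Lemma trivext_mul1x : left_id trivext_one trivext_mul.
Proof.
move=> [a f]; congr (_, _) => /=; first by rewrite mul1r.
by apply/lfunP=> x; rewrite !lE mulr1 addr0.
Qed.

Lemma trivext_mulx1 : right_id trivext_one trivext_mul.
Proof.
move=> [a f]; congr (_, _) => /=; first by rewrite mulr1.
by apply/lfunP=> x; rewrite !lE mul1r add0r.
Qed.

Lemma trivext_mulDl : left_distributive trivext_mul +%R.
Proof.
move=> [a f] [b g] [c h]; congr (_, _) => /=; first by rewrite mulrDl.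
by apply/lfunP=> x; rewrite !lE /= mulrDr linearD /= addrACA.
Qed.

Lemma trivext_mulDr : right_distributive trivext_mul +%R.
Proof.
move=> [a f] [b g] [c h]; congr (_, _) => /=; first by rewrite mulrDr.
by apply/lfunP=> x; rewrite !lE /= mulrDl linearD /= addrACA.
Qed.

Lemma trivext_one_neq0 : trivext_one != 0.
Proof. by apply/eqP=> -[/eqP]; rewrite oner_eq0. Qed.

HB.instance Definition _ := GRing.Zmodule_isNzRing.Build trivext
  trivext_mulA trivext_mul1x trivext_mulx1 trivext_mulDl trivext_mulDr
  trivext_one_neq0.

Lemma trivext_scaleAl (c : K) (x y : trivext) : c *: (x * y) = (c *: x) * y.
Proof.
case: x y => [a f] [b g]; congr (_, _) => /=; first by rewrite scalerAl.
by apply/lfunP=> x; rewrite !lE /= scalerDr -scalerAr linearZ.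
Qed.

HB.instance Definition _ :=
  GRing.Lmodule_isLalgebra.Build K trivext trivext_scaleAl.

Lemma trivext_scaleAr (c : K) (x y : trivext) : c *: (x * y) = x * (c *: y).
Proof.
case: x y => [a f] [b g]; congr (_, _) => /=; first by rewrite scalerAr.
by apply/lfunP=> x; rewrite !lE /= scalerDr -scalerAl linearZ.
Qed.

HB.instance Definition _ :=
  GRing.Lalgebra_isAlgebra.Build K trivext trivext_scaleAr.

HB.instance Definition _ := Algebra_isFalgebra.Build K trivext.

End TrivialExtension.

HB.mixin Record Lmodule_isLieAlgebra (K : fieldType) L of GRing.Lmodule K L := {
  lie : L -> L -> L;
  lie_linearl : forall z : L, linear (lie^~ z);
  lie_linearr : forall z : L, linear (lie z);
  liexx : forall x : L, lie x x = 0;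
  lie_jacobi : forall x y z : L,
    lie x (lie y z) + lie y (lie z x) + lie z (lie x y) = 0
}.

#[short(type="lieAlgType")]
HB.structure Definition LieAlgebra (K : fieldType) :=
  {L of GRing.Lmodule K L & Lmodule_isLieAlgebra K L}.

Section Solvable.

Variables (K : fieldType) (L : lieAlgType K).

Fixpoint lie_derived (n : nat) (x : L) : Prop :=
  if n is n'.+1 then
    exists (m : nat) (c : 'I_m -> K) (y z : 'I_m -> L),
      (forall i, lie_derived n' (y i) /\ lie_derived n' (z i)) /\
      x = \sum_i c i *: lie (y i) (z i)
  else True.

Definition lie_solvable : Prop :=
  exists n, forall x, lie_derived n x -> x = 0.

End Solvable.

Section HH1.

Variables (K : fieldType) (C : falgType K).

Definition derivation : {pred 'End(C)} :=
  [pred d : 'End(C) | `[< forall x y, d (x * y) = d x * y + x * d y >]].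

Lemma derivationP (d : 'End(C)) :
  reflect (forall x y, d (x * y) = d x * y + x * d y) (d \in derivation).
Proof. exact: asboolP. Qed.

Lemma derivation_submod : submod_closed derivation.
Proof.
split=> [|c d e /derivationP hd /derivationP he]; apply/derivationP=> x y.
  by rewrite !zero_lfunE mul0r mulr0 addr0.
rewrite !add_lfunE !scale_lfunE hd he scalerDr mulrDl mulrDr.
by rewrite -scalerAl -scalerAr addrACA.
Qed.

HB.instance Definition _ :=
  GRing.isSubmodClosed.Build K 'End(C) derivation derivation_submod.

Record der := Der { der_val :> 'End(C); _ : der_val \in derivation }.
HB.instance Definition _ := [isSub for der_val].
HB.instance Definition _ := [Choice of der by <:].
HB.instance Definition _ := [SubChoice_isSubLmodule of der by <:].

Lemma derM (d : der) x y : d (x * y) = d x * y + x * d y.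
Proof. by have /derivationP := valP d. Qed.

Definition commutator (d e : 'End(C)) : 'End(C) :=
  (d \o e)%VF - (e \o d)%VF.

Lemma commutatorE (d e : 'End(C)) x : commutator d e x = d (e x) - e (d x).
Proof. by rewrite /commutator add_lfunE opp_lfunE !comp_lfunE. Qed.

Let addr8 (V : zmodType) (a b c f g h : V) :
  a + b + (c + f) + (- (g + c) - (b + h)) = a - g + (f - h).
Proof.
rewrite !opprD [LHS](AC ((2*2)*(2*2)) ((1*5)*(4*8)*((2*7)*(3*6)))) /=.
by rewrite !subrr !addr0.
Qed.

Let addr12 (V : zmodType) (a b c d e f : V) :
  a - b + (- c - - d) + (c - e + (- f - - b)) + (f - d + (- a - - e)) = 0.
Proof.
rewrite !opprK [LHS](AC (((2*2)*(2*2))*(2*2))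
  ((1*11)*(8*2)*(5*3)*(4*10)*(12*6)*(9*7))) /=.
by rewrite !subrr !addr0.
Qed.

Lemma commutator_derivation (d e : der) : commutator d e \in derivation.
Proof.
apply/derivationP=> x y; rewrite !commutatorE !derM !linearD /= !derM.
by rewrite mulrBl mulrBr addr8.
Qed.

Definition der_lie (d e : der) : der := Der (commutator_derivation d e).

Lemma der_eqP (d e : der) : (forall x, d x = e x) -> d = e.
Proof. by move=> h; apply: val_inj; apply/lfunP. Qed.

Lemma der_lin c (d e : der) x : (c *: d + e) x = c *: d x + e x.
Proof. by rewrite -[LHS]/((c *: val d + val e) x) add_lfunE scale_lfunE. Qed.

Lemma der_addE (d e : der) x : (d + e) x = d x + e x.
Proof. by have := der_lin 1 d e x; rewrite !scale1r. Qed.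

Lemma der_subE (d e : der) x : (d - e) x = d x - e x.
Proof. by have := der_lin (-1) e d x; rewrite !scaleN1r ![- _ + _]addrC. Qed.

Lemma der_lieE (d e : der) x : der_lie d e x = d (e x) - e (d x).
Proof. exact: commutatorE. Qed.

Fact der_lie_linearl f : linear (der_lie^~ f).
Proof.
move=> c d e; apply: der_eqP => x.
rewrite der_lin !der_lieE !der_lin linearP /= scalerBr.
by rewrite opprD addrACA.
Qed.

Fact der_lie_linearr f : linear (der_lie f).
Proof.
move=> c d e; apply: der_eqP => x.
rewrite der_lin !der_lieE !der_lin linearP /= scalerBr.
by rewrite opprD addrACA.
Qed.

Fact der_liexx d : der_lie d d = 0.
Proof. by apply: der_eqP => x; rewrite der_lieE subrr zero_lfunE. Qed.

Fact der_lie_jacobi d e f :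
  der_lie d (der_lie e f) + der_lie e (der_lie f d) +
  der_lie f (der_lie d e) = 0.
Proof.
apply: der_eqP => x.
rewrite !der_addE !der_lieE !linearB /= zero_lfunE.
exact: addr12.
Qed.

HB.instance Definition _ := Lmodule_isLieAlgebra.Build K der
  der_lie_linearl der_lie_linearr der_liexx der_lie_jacobi.

Lemma lieE (d e : der) x : lie d e x = d (e x) - e (d x).
Proof. exact: der_lieE. Qed.

Definition inner : {pred der} :=
  [pred d : der | `[< exists a : C, forall x, d x = a * x - x * a >]].

Lemma innerP (d : der) :
  reflect (exists a : C, forall x, d x = a * x - x * a) (d \in inner).
Proof. exact: asboolP. Qed.

Lemma inner_submod : submod_closed inner.
Proof.
split=> [|c d e /innerP[a ha] /innerP[b hb]]; apply/innerP.
  by exists 0 => x; rewrite zero_lfunE mul0r mulr0 subrr.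
exists (c *: a + b) => x; rewrite der_lin ha hb scalerBr mulrDl mulrDr.
by rewrite -scalerAl -scalerAr opprD addrACA.
Qed.

HB.instance Definition _ :=
  GRing.isSubmodClosed.Build K der inner inner_submod.

Lemma inner_lier (d e : der) : e \in inner -> lie d e \in inner.
Proof.
case/innerP=> a ha; apply/innerP; exists (d a) => x.
rewrite lieE !ha linearB /= !derM.
rewrite opprB opprD [LHS](AC ((2*2)*2) ((1*4)*((2*6)*(5*3)))) /=.
by rewrite !subrr !addr0.
Qed.

Lemma lieC (d e : der) : lie d e = - lie e d.
Proof.
apply: der_eqP => x; rewrite -[- _]sub0r der_subE zero_lfunE sub0r.
by rewrite !lieE opprB.
Qed.

Lemma inner_liel (d e : der) : d \in inner -> lie d e \in inner.
Proof. by move=> id; rewrite lieC rpredN inner_lier. Qed.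

Local Open Scope quotient_scope.

Definition HH1 : Type := {ideal_quot inner}.

HB.instance Definition _ := GRing.Zmodule.on HH1.

Definition hh1_class (d : der) : HH1 := \pi_{ideal_quot inner} d.

Lemma hh1_classP (d e : der) :
  hh1_class d = hh1_class e <-> d - e \in inner.
Proof. by rewrite Quotient.idealrBE; split=> [|] /eqP. Qed.

Fact hh1_class_is_zmod : zmod_morphism hh1_class.
Proof. by move=> d e; rewrite /hh1_class raddfB. Qed.
HB.instance Definition _ :=
  GRing.isZmodMorphism.Build der HH1 hh1_class hh1_class_is_zmod.

Definition hh1_repr (x : HH1) : der := generic_quotient.repr x.

Lemma hh1_reprK x : hh1_class (hh1_repr x) = x.
Proof. exact: reprK. Qed.

Definition hh1_scale (c : K) (x : HH1) : HH1 := hh1_class (c *: hh1_repr x).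
Definition hh1_lie (x y : HH1) : HH1 :=
  hh1_class (lie (hh1_repr x) (hh1_repr y)).

Lemma hh1_scaleE c d : hh1_scale c (hh1_class d) = hh1_class (c *: d).
Proof.
apply/hh1_classP; rewrite -scalerBr rpredZ //.
by apply/hh1_classP; rewrite hh1_reprK.
Qed.

Lemma hh1_lieE d e : hh1_lie (hh1_class d) (hh1_class e) = hh1_class (lie d e).
Proof.
set d' := hh1_repr (hh1_class d); set e' := hh1_repr (hh1_class e).
have hd : d' - d \in inner by apply/hh1_classP; rewrite hh1_reprK.
have he : e' - e \in inner by apply/hh1_classP; rewrite hh1_reprK.
apply/hh1_classP; rewrite -/d' -/e'.
have -> : lie d' e' - lie d e = lie (d' - d) e' + lie d (e' - e).
  apply: der_eqP => x; rewrite der_subE der_addE !lieE.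
  rewrite !der_subE !linearB /= !opprK.
  rewrite [RHS](AC ((2*2)*(2*2)) ((1*3)*(6*8)*((5*2)*(4*7)))) /=.
  by rewrite !subrr !addr0.
by apply: rpredD; [exact: inner_liel | exact: inner_lier].
Qed.

Fact hh1_scaleA a b x : hh1_scale a (hh1_scale b x) = hh1_scale (a * b) x.
Proof. by rewrite -(hh1_reprK x) !hh1_scaleE scalerA. Qed.
Fact hh1_scale1 : left_id 1 hh1_scale.
Proof. by move=> x; rewrite -(hh1_reprK x) hh1_scaleE scale1r. Qed.
Fact hh1_scaleDr : right_distributive hh1_scale +%R.
Proof.
move=> c x y; rewrite -(hh1_reprK x) -(hh1_reprK y) -raddfD !hh1_scaleE.
by rewrite scalerDr raddfD.
Qed.
Fact hh1_scaleDl x : {morph hh1_scale^~ x : a b / a + b}.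
Proof.
by move=> a b; rewrite -(hh1_reprK x) !hh1_scaleE scalerDl raddfD.
Qed.

HB.instance Definition _ := GRing.Zmodule_isLmodule.Build K HH1
  hh1_scaleA hh1_scale1 hh1_scaleDr hh1_scaleDl.

Fact hh1_class_scalable : scalable hh1_class.
Proof. by move=> c d; rewrite -hh1_scaleE. Qed.
HB.instance Definition _ :=
  GRing.isScalable.Build K der HH1 _ hh1_class hh1_class_scalable.

Fact hh1_lie_linearl z : linear (hh1_lie^~ z).
Proof.
move=> c x y; rewrite -(hh1_reprK x) -(hh1_reprK y) -(hh1_reprK z).
by rewrite -linearP !hh1_lieE lie_linearl linearP.
Qed.
Fact hh1_lie_linearr z : linear (hh1_lie z).
Proof.
move=> c x y; rewrite -(hh1_reprK x) -(hh1_reprK y) -(hh1_reprK z).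
by rewrite -linearP !hh1_lieE lie_linearr linearP.
Qed.
Fact hh1_liexx x : hh1_lie x x = 0.
Proof. by rewrite -(hh1_reprK x) hh1_lieE liexx linear0. Qed.
Fact hh1_lie_jacobi x y z :
  hh1_lie x (hh1_lie y z) + hh1_lie y (hh1_lie z x) + hh1_lie z (hh1_lie x y)
  = 0.
Proof.
rewrite -(hh1_reprK x) -(hh1_reprK y) -(hh1_reprK z) !hh1_lieE.
by rewrite -!linearD lie_jacobi linear0.
Qed.

HB.instance Definition _ := Lmodule_isLieAlgebra.Build K HH1
  hh1_lie_linearl hh1_lie_linearr hh1_liexx hh1_lie_jacobi.

Lemma hh1_classL d e :
  hh1_class (lie d e) = lie (hh1_class d) (hh1_class e).
Proof. by rewrite -hh1_lieE. Qed.

End HH1.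

Section Kronecker.

Fact bool_card_gt0 : (0 < #|{: bool}|)%N. Proof. by rewrite card_bool. Qed.

Definition kronecker_quiver : quiver :=
  @Quiver bool bool (fun=> false) (fun=> true) bool_card_gt0.

Variable K : fieldType.

Definition kronecker : Type := path_algebra K kronecker_quiver.

HB.instance Definition _ := GRing.Algebra.on kronecker.

Let kpath (i : 'I_4) : qpath kronecker_quiver :=
  match val i with
  | 0 => @trivial_path kronecker_quiver false
  | 1 => @trivial_path kronecker_quiver true
  | 2 => @arrow_path kronecker_quiver false
  | _ => @arrow_path kronecker_quiver true
  end.

Let kindex (p : qpath kronecker_quiver) : 'I_4 :=
  match val p with
  | (v, [::]) => inord v
  | (_, a :: _) => inord (2 + a)
  end.

Let kpathK : cancel kpath kindex.
Proof.
by case=> [[|[|[|[|]]]]] // h; apply: val_inj; rewrite /kindex /= inordK.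
Qed.

Let kindexK : cancel kindex kpath.
Proof.
case=> [[v [|a [|b s]]] h]; apply: val_inj; rewrite /kpath /kindex /=.
- by case: v h => h; rewrite inordK.
- by case: v h => h //; case: a h => h; rewrite inordK.
- by move: h => /=; case: v.
Qed.

Fact kronecker_vect : Vector.axiom 4 kronecker.
Proof.
exists (fun x => \row_i pcoef (kpath i) x) => [c x y|].
  by apply/rowP=> i; rewrite !mxE linearP.
exists (fun r : 'rV_4 => \sum_i r 0 i *: pbasis K (kpath i)) => [x|r].
  apply: pcoefP => p; rewrite linear_sum /= (bigD1 (kindex p)) //= mxE.
  rewrite linearZ /= pcoef_basis kindexK eqxx mulr1 big1 ?addr0 // => i ni.
  rewrite linearZ /= pcoef_basis (_ : (_ == _) = false) ?mulr0 //.
  by apply: contraNF ni => /eqP <-; rewrite kpathK.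
apply/rowP=> i; rewrite mxE linear_sum /= (bigD1 i) //=.
rewrite linearZ /= pcoef_basis eqxx mulr1 big1 ?addr0 // => j nj.
rewrite linearZ /= pcoef_basis (_ : (_ == _) = false) ?mulr0 //.
by rewrite (can_eq kpathK) (negbTE nj).
Qed.

HB.instance Definition _ := Lmodule_hasFinDim.Build K kronecker kronecker_vect.
HB.instance Definition _ := Algebra_isFalgebra.Build K kronecker.

End Kronecker.

(* Main.v *)
From HB Require Import structures.
Require Import Defs.
From mathcomp Require Import all_boot all_order all_algebra all_field.
From mathcomp Require Import boolp.

Set Implicit Arguments.
Unset Strict Implicit.
Unset Printing Implicit Defensive.

Import GRing.Theory.

Local Open Scope ring_scope.

(** Let e_v be the vertex idempotents of an algebra C.  A derivation of C is,
    up to an inner one, zero on every e_v ([der_normalize]); it then preserves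
    the space of elements running between two given vertices and is determined
    by its values on a set of generators.  Suppose that the generators carry
    weights for which every such derivation sends each generator to a multiple
    of itself plus terms of larger weight.  A commutator of two of them raises
    the weight, further commutators raise it further, and weights are bounded
    because C is finite dimensional: HH1(C) is solvable
    ([solvable_of_filtration]).

    The weights 2 and 3 suffice.  A product of two generators has weight at
    least 4, and the component of d(g) along a vertex is zero, because g^2 = 0
    and 2 is invertible.  What is left is the component of d(g) along a
    generator h parallel to g.  So HH1(C) is solvable unless there are two
    consecutive non-zero components, of d(g) along h and of d'(h) along h'
    ([table_solvable]).

    Both A and TA have a basis whose products are basis elements or zero: the
    paths p without relations, respectively the p together with the dual
    elements p*, where p q* = r* if q = r p, and q* p = r* if q = p r.  If
    k h <> 0 then k g = 0 for the other generators g, and the coefficient of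
    k h in 0 = d(k g) = d(k) g + k d(g) is the component of d(g) along h, unless
    k h is also a left multiple of g.  This forces the component to vanish
    except when h is isolated: for A, an arrow that is a maximal path
    ([gen_der_maximal]); for TA, such an arrow or its dual
    ([tgen_der_arrow]).  Hence a failure of solvability needs two distinct
    isolated elements h and h' between the same vertices.  An isolated loop and
    its dual are ruled out because 2 is invertible.  Otherwise the gentle axioms
    and connectedness leave no room for further arrows or vertices
    ([exceptional_basis]), so that A is the Kronecker algebra or, for TA only,
    the oriented 2-cycle with radical square zero.  These two algebras have
    isomorphic trivial extensions: exchange one arrow with its dual
    ([two_arrow_trivext_swap]).

    Conversely, the two derivations of the Kronecker algebra sending one arrow
    to the other generate a copy of sl2 ([has_sl2_parallel]), which the map
    d |-> (d, -d^T) carries to the trivial extension.  As 2 is invertible, sl2 is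
    perfect, and it survives in HH1 ([sl2_not_solvable]). *)

(** * Solvability of HH1 from a filtration *)

Section InnerDerivations.

Variables (K : fieldType) (C : falgType K).

Lemma ad_derivation (a : C) : (amull a - amulr a)%R \in @derivation K C.
Proof.
apply/derivationP => x y.
rewrite !add_lfunE !opp_lfunE !lfunE /= mulrBl mulrBr !mulrA.
by rewrite addrA subrK.
Qed.

Definition ad (a : C) : der C := Der (ad_derivation a).

Lemma adE a x : ad a x = a * x - x * a.
Proof. by rewrite /= add_lfunE opp_lfunE !lfunE. Qed.

Lemma ad_inner a : ad a \in @inner K C.
Proof. by apply/innerP; exists a => x; rewrite adE. Qed.

Variables (V : finType) (e : V -> C).

Definition der0 (d : der C) := forall v, d (e v) = 0.

Hypothesis e_orth : forall u v, e u * e v = if u == v then e u else 0.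
Hypothesis e_sum : \sum_v e v = 1.

(** The inner derivation to subtract is that of a = \sum_v d(e_v) e_v: in a
    Peirce decomposition it agrees with d on every e_u. *)
Lemma der_normalize (d : der C) : exists2 d0, der0 d0 & d - d0 \in @inner K C.
Proof.
pose a := \sum_v d (e v) * e v.
exists (d - ad a); last by rewrite opprB addrC subrK ad_inner.
move=> u; rewrite der_subE adE.
have ee v : e v * e v = e v by rewrite e_orth eqxx.
have uu : e u * d (e u) * e u = 0.
  have := derM d (e u) (e u); rewrite ee => /(congr1 (fun t => e u * t * e u)).
  rewrite mulrDr mulrDl !mulrA -[X in _ = X + _]mulrA !ee => /eqP.
  by rewrite -subr_eq subrr eq_sym => /eqP.
have -> : a * e u = d (e u) * e u.
  rewrite /a mulr_suml (bigD1 u) //= -mulrA ee big1 ?addr0 // => v nv.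
  by rewrite -mulrA e_orth (negbTE nv) mulr0.
have -> : e u * a = d (e u) * e u - d (e u).
  have -> : d (e u) = \sum_v d (e u) * e v by rewrite -mulr_sumr e_sum mulr1.
  rewrite mulr_suml (bigD1 u) //= -mulrA ee big1 ?addr0; last first.
    by move=> v nv; rewrite -mulrA e_orth (negbTE nv) mulr0.
  rewrite [in RHS](bigD1 u) //= opprD addrA subrr add0r -sumrN /a mulr_sumr.
  rewrite (bigD1 u) //= mulrA uu add0r.
  apply: eq_bigr => v nv; rewrite mulrA.
  have -> : e u * d (e v) = - (d (e u) * e v).
    have /eqP := derM d (e u) (e v).
    rewrite e_orth [u == v]eq_sym (negbTE nv) linear0 eq_sym addrC addr_eq0.
    by move/eqP.
  by rewrite mulNr -mulrA ee.
by rewrite subKr subrr.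
Qed.

End InnerDerivations.

Section Filtration.

Variables (K : fieldType) (C : falgType K).
Variables (V : finType) (e : V -> C) (G : Type) (x : G -> C) (w : G -> nat).

(** The smallest multiplicative filtration in which x_g has degree at least
    w g; degree 0 is the whole algebra. *)
Inductive filt : nat -> C -> Prop :=
| filt_all c : filt 0 c
| filt_gen g : filt (w g) (x g)
| filt_mul i j c c' : filt i c -> filt j c' -> filt (i + j) (c * c')
| filt_zero i : filt i 0
| filt_lin i a c c' : filt i c -> filt i c' -> filt i (a *: c + c')
| filt_le i j c : (j <= i)%N -> filt i c -> filt j c.

Lemma filtD i c c' : filt i c -> filt i c' -> filt i (c + c').
Proof. by move=> h h'; rewrite -[c]scale1r; apply: filt_lin. Qed.

Lemma filtZ i a c : filt i c -> filt i (a *: c).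
Proof.
by move=> h; rewrite -[_ *: _]addr0; apply: filt_lin => //; apply: filt_zero.
Qed.

Lemma filtB i c c' : filt i c -> filt i c' -> filt i (c - c').
Proof. by move=> h h'; apply: filtD => //; rewrite -scaleN1r; apply: filtZ. Qed.

Lemma filt_sum i I (r : seq I) (P : pred I) (F : I -> C) :
  (forall k, P k -> filt i (F k)) -> filt i (\sum_(k <- r | P k) F k).
Proof. by move=> h; apply: big_ind => //; [exact: filt_zero|exact: filtD]. Qed.

Hypothesis e_orth : forall u v, e u * e v = if u == v then e u else 0.
Hypothesis e_sum : \sum_v e v = 1.
Hypothesis generated : forall P : C -> Prop,
  (forall v, P (e v)) -> (forall g, P (x g)) ->
  (forall a c c', P c -> P c' -> P (a *: c + c')) ->
  (forall c c', P c -> P c' -> P (c * c')) -> forall c, P c.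

Definition shifts (k : nat) (d : der C) := forall g, filt (w g + k) (d (x g)).

Lemma shifts_all k d : der0 e d -> shifts k d -> forall c, filt k (d c).
Proof.
move=> d0 sd; apply: generated => [v|g|a c c' h h'|c c' h h'].
- by rewrite d0; exact: filt_zero.
- by apply: filt_le (sd g); rewrite leq_addl.
- by rewrite linearP; apply: filt_lin.
rewrite derM; apply: filtD.
  by rewrite -[k]addn0; apply: filt_mul => //; exact: filt_all.
by rewrite -[k]add0n; apply: filt_mul => //; exact: filt_all.
Qed.

Lemma shifts_filt k d : der0 e d -> shifts k d ->
  forall i c, filt i c -> filt (i + k) (d c).
Proof.
move=> d0 sd i c; elim=> {i c}.
- by move=> c; rewrite add0n; exact: shifts_all.
- by [].
- move=> i j c c' hc IH hc' IH'; rewrite derM; apply: filtD.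
    by rewrite addnAC; apply: filt_mul.
  by rewrite -addnA; apply: filt_mul.
- by move=> i; rewrite linear0; exact: filt_zero.
- by move=> i a c c' _ h _ h'; rewrite linearP; exact: filt_lin.
by move=> i j c le _; apply: filt_le; rewrite leq_add2r.
Qed.

Hypothesis triangular : forall d, der0 e d ->
  forall g, exists a, filt (w g).+1 (d (x g) - a *: x g).

Lemma shifts0 d : der0 e d -> shifts 0 d.
Proof.
move=> d0 g; have [a ha] := triangular d0 g; rewrite addn0.
rewrite -[d (x g)](subrK (a *: x g)); apply: filtD; first exact: filt_le ha.
by apply: filtZ; exact: filt_gen.
Qed.

(** The leading terms of d and d' on x_g are scalars, so they cancel in the
    commutator. *)
Lemma shifts_lie0 d d' : der0 e d -> der0 e d' -> shifts 1 (lie d d').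
Proof.
move=> d0 d0' g; rewrite addn1 lieE.
have [a ha] := triangular d0 g; have [b hb] := triangular d0' g.
have hd := shifts_filt d0 (shifts0 d0) hb.
rewrite addn0 linearB linearZ /= in hd.
have hd' := shifts_filt d0' (shifts0 d0') ha.
rewrite addn0 linearB linearZ /= in hd'.
have -> : d (d' (x g)) - d' (d (x g)) =
    (d (d' (x g)) - b *: d (x g)) - (d' (d (x g)) - a *: d' (x g)) +
    (b *: (d (x g) - a *: x g) - a *: (d' (x g) - b *: x g)).
  rewrite !scalerBr !scalerA [b * a]mulrC !opprB !addrA.
  by rewrite [RHS](AC 8 ((1*4)*(2*5)*(3*8)*(6*7))) /= !addNr subrr !addr0.
by apply: filtD; apply: filtB => //; exact: filtZ.
Qed.

Lemma shifts_lie k d d' : der0 e d -> der0 e d' -> shifts k d -> shifts k d' ->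
  shifts (k + k) (lie d d').
Proof.
move=> d0 d0' h h' g; rewrite lieE addnA; apply: filtB; exact: shifts_filt.
Qed.

Lemma der0_lin a d d' : der0 e d -> der0 e d' -> der0 e (a *: d + d').
Proof. by move=> h h' v; rewrite der_lin h h' scaler0 addr0. Qed.

Lemma der0_lie d d' : der0 e d -> der0 e d' -> der0 e (lie d d').
Proof. by move=> h h' v; rewrite lieE h h' !linear0 addr0. Qed.

(** From the first derived algebra on, each step raises the degree: brackets
    of maps of degree n >= 1 have degree 2n, which is at least n + 1. *)
Lemma der0_derived n (y : HH1 C) : lie_derived n y ->
  exists d, [/\ der0 e d, hh1_class d = y & (0 < n)%N -> shifts n d].
Proof.
elim: n y => [|n IH] y /=.
  move=> _; have [d d0 hd] := der_normalize e_orth e_sum (hh1_repr y).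
  exists d; split=> //; rewrite -(hh1_reprK y); apply/esym/hh1_classP.
  exact: hd.
case=> m [c [u [v [huv ->]]]] {y}.
pose P (y : HH1 C) :=
  exists d, [/\ der0 e d, hh1_class d = y & (0 < n.+1)%N -> shifts n.+1 d].
have P0 : P 0.
  exists 0; split; first by move=> w0; rewrite zero_lfunE.
    by rewrite linear0.
  by move=> _ g; rewrite zero_lfunE; exact: filt_zero.
have PD a y z : P y -> P z -> P (a *: y + z).
  case=> d [d0 <- hd] [d' [d0' <- hd']]; exists (a *: d + d'); split.
  - exact: der0_lin.
  - by rewrite linearP.
  by move=> l g; rewrite der_lin; apply: filt_lin; [exact: hd|exact: hd'].
have PL i : P (lie (u i) (v i)).
  have [/IH[d [d0 <- hd]] /IH[d' [d0' <- hd']]] := huv i.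
  exists (lie d d'); split; [exact: der0_lie | exact: hh1_classL |] => _.
  case: (posnP n) hd hd' => [->|n0] hd hd'; first exact: shifts_lie0.
  move=> g; apply: (filt_le _ (shifts_lie d0 d0' (hd isT) (hd' isT) g)).
  by rewrite leq_add2l -addn1 leq_add2l.
elim/big_rec: _ => // i y _ Py; exact: PD.
Qed.

Lemma solvable_of_filtration :
  (exists N, forall c, filt N c -> c = 0) -> lie_solvable (HH1 C).
Proof.
case=> N hN; exists N.+1 => y /der0_derived[d [d0 <- /(_ isT) sd]].
rewrite (_ : d = 0) ?linear0 //; apply: der_eqP => c; rewrite zero_lfunE.
by apply: hN; apply: filt_le (shifts_all d0 sd c).
Qed.

End Filtration.

(** * Algebras with a multiplicative basis *)

(** The value None of mu x y stands for a zero product of basis elements. *)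
Record mult_basis (K : fieldType) (C : algType K) (X : finType)
    (mu : X -> X -> option X) := MultBasis {
  el : X -> C;
  co : X -> C -> K;
  co_linear : forall x, linear_for *%R (co x);
  co_el : forall x y, co x (el y) = (x == y)%:R;
  el_span : forall c, c = \sum_x co x c *: el x;
  el_mul : forall x y, el x * el y = oapp el 0 (mu x y)
}.

HB.instance Definition _ K C X mu (B : @mult_basis K C X mu) x :=
  GRing.isLinear.Build K C K _ (co B x) (co_linear B x).

Section MultBasis.

Variables (K : fieldType) (C : algType K) (X : finType).
Variables (mu : X -> X -> option X) (B : mult_basis C mu).

Lemma coP c c' : (forall x, co B x c = co B x c') -> c = c'.
Proof.
move=> h; rewrite (el_span B c) (el_span B c').
by apply: eq_bigr => x _; rewrite h.
Qed.

Lemma co_elmul z x y : co B z (el B x * el B y) = (mu x y == Some z)%:R.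
Proof.
rewrite el_mul; case: (mu x y) => [t|] /=; last by rewrite linear0.
by rewrite co_el eq_sym.
Qed.

Lemma co_lmul z k c :
  co B z (el B k * c) = \sum_(x | mu k x == Some z) co B x c.
Proof.
rewrite [c in LHS](el_span B) mulr_sumr linear_sum /= [RHS]big_mkcond /=.
apply: eq_bigr => x _; rewrite -scalerAr linearZ /= co_elmul.
by case: eqP; rewrite (mulr1, mulr0).
Qed.

Lemma co_rmul z k c :
  co B z (c * el B k) = \sum_(x | mu x k == Some z) co B x c.
Proof.
rewrite [c in LHS](el_span B) mulr_suml linear_sum /= [RHS]big_mkcond /=.
apply: eq_bigr => x _; rewrite -scalerAl linearZ /= co_elmul.
by case: eqP; rewrite (mulr1, mulr0).
Qed.

Lemma co_mul_neq0 z c c' : co B z (c * c') != 0 ->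
  exists x y, [/\ co B x c != 0, co B y c' != 0 & mu x y = Some z].
Proof.
rewrite [c in c * _](el_span B) mulr_suml linear_sum /= => h.
have /existsP[x hx] : [exists x, co B z (co B x c *: el B x * c') != 0].
  apply: contraNT h => /existsPn h; rewrite big1 // => x _.
  exact/eqP/negPn/h.
move: hx; rewrite -scalerAl linearZ /= mulf_eq0 negb_or => /andP[hx].
rewrite co_lmul => hy.
have /existsP[y /andP[/eqP m hy']] :
    [exists y, (mu x y == Some z) && (co B y c' != 0)].
  apply: contraNT hy => /existsPn hy; rewrite big1 // => y m.
  by have := hy y; rewrite m /= negbK => /eqP.
by exists x, y.
Qed.

End MultBasis.

(** The combinatorics of a basis of paths.  The product is that of functions:
    in mul x y the path y comes first.  The rank is a grading, such as the
    length, whose elements of degree 0 are the trivial paths vx v; the elements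
    of gen generate all those of positive rank. *)
Record table (V X : finType) := Table {
  mul : X -> X -> option X;
  vx : V -> X;
  src : X -> V;
  tgt : X -> V;
  rk : X -> nat;
  gen : pred X;
  mul_vx : forall x v, mul x (vx v) = if v == src x then Some x else None;
  vx_mul : forall x v, mul (vx v) x = if v == tgt x then Some x else None;
  src_vx : forall v, src (vx v) = v;
  tgt_vx : forall v, tgt (vx v) = v;
  rk_mul : forall x y z, mul x y = Some z -> rk z = (rk x + rk y)%N;
  rk0_vx : forall x, rk x = 0%N -> x = vx (src x);
  mul_injl : forall x y y' z, mul x y = Some z -> mul x y' = Some z -> y = y';
  mul_injr : forall x x' y z, mul x y = Some z -> mul x' y = Some z -> x = x';
  gen_rk : forall g, gen g -> (0 < rk g)%N;
  gen_gen : forall g, gen g -> mul g g = None;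
  gen_dec : forall x, (0 < rk x)%N -> gen x \/
    exists y z, [/\ (0 < rk y)%N, (0 < rk z)%N & mul y z = Some x]
}.

Section TableAlgebra.

Variables (V X : finType) (T : table V X).

Lemma rk_vx v : rk T (vx T v) = 0%N.
Proof.
have := vx_mul T (vx T v) v; rewrite tgt_vx eqxx => /rk_mul /eqP.
by rewrite -[X in X == _]addn0 eqn_add2l eq_sym => /eqP.
Qed.

Variables (K : fieldType) (C : falgType K) (B : mult_basis C (mul T)).
Hypothesis two_neq0 : 2%:R != 0 :> K.

Local Notation e := (fun v => el B (vx T v)).

Lemma co_lmulE k h z c : mul T k h = Some z -> co B z (el B k * c) = co B h c.
Proof.
move=> m; rewrite co_lmul (bigD1 h) ?m //= big1 ?addr0 // => x /andP[/eqP m'].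
by rewrite (mul_injl m m') eqxx.
Qed.

Lemma co_rmulE k h z c : mul T h k = Some z -> co B z (c * el B k) = co B h c.
Proof.
move=> m; rewrite co_rmul (bigD1 h) ?m //= big1 ?addr0 // => x /andP[/eqP m'].
by rewrite (mul_injr m m') eqxx.
Qed.

Lemma co_lmul0 k z c :
  (forall x, mul T k x <> Some z) -> co B z (el B k * c) = 0.
Proof. by move=> h; rewrite co_lmul big1 // => x /eqP /h. Qed.

Lemma co_rmul0 k z c :
  (forall x, mul T x k <> Some z) -> co B z (c * el B k) = 0.
Proof. by move=> h; rewrite co_rmul big1 // => x /eqP /h. Qed.

Lemma e_orth u v : e u * e v = if u == v then e u else 0.
Proof.
by rewrite el_mul mul_vx src_vx eq_sym; case: eqP.
Qed.

Lemma e_sum : \sum_v e v = 1.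
Proof.
suff h c : (\sum_v e v) * c = c by rewrite -[LHS]mulr1 h.
rewrite [c in LHS](el_span B) [RHS](el_span B) mulr_sumr; apply: eq_bigr => x _.
rewrite -scalerAr mulr_suml (bigD1 (tgt T x)) //= el_mul vx_mul eqxx /=.
rewrite big1 ?addr0 // => v nv; by rewrite el_mul vx_mul (negbTE nv).
Qed.

Section Derivation.

Variable d : der C.

(** Compare the coefficients of k h in 0 = d(k g) = d(k) g + k d(g). *)
Lemma co_der_eq0_left g h k z :
  mul T k h = Some z -> mul T k g = None -> (forall y, mul T y g <> Some z) ->
  co B h (d (el B g)) = 0.
Proof.
move=> kh kg nz; rewrite -(co_lmulE _ kh).
have := derM d (el B k) (el B g); rewrite el_mul kg linear0.
move/(congr1 (co B z)).
by rewrite linear0 linearD /= (co_rmul0 _ nz) add0r => <-.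
Qed.

(** Compare the coefficients of h k in 0 = d(g k) = d(g) k + g d(k). *)
Lemma co_der_eq0_right g h k z :
  mul T h k = Some z -> mul T g k = None -> (forall y, mul T g y <> Some z) ->
  co B h (d (el B g)) = 0.
Proof.
move=> hk gk nz; rewrite -(co_rmulE _ hk).
have := derM d (el B g) (el B k); rewrite el_mul gk linear0.
move/(congr1 (co B z)).
by rewrite linear0 linearD /= (co_lmul0 _ nz) addr0 => <-.
Qed.

(** Both terms of 0 = d(g g) = d(g) g + g d(g) contribute the same
    coefficient, and 2 is invertible. *)
Lemma co_der_eq0_square g h z :
  mul T g g = None -> mul T h g = Some z -> mul T g h = Some z ->
  co B h (d (el B g)) = 0.
Proof.
move=> gg hg gh.
have := derM d (el B g) (el B g); rewrite el_mul gg linear0.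
move/(congr1 (co B z)).
rewrite linear0 linearD /= (co_rmulE _ hg) (co_lmulE _ gh) -mulr2n -mulr_natl.
by move/esym/eqP; rewrite mulf_eq0 (negbTE two_neq0) => /eqP.
Qed.

Hypothesis d0 : der0 e d.

Lemma co_der_parallel g x : co B x (d (el B g)) != 0 ->
  src T x = src T g /\ tgt T x = tgt T g.
Proof.
move=> nz; split; apply/eqP; apply: contraNT nz => ne; apply/eqP.
  have E : d (el B g) = d (el B g) * e (src T g).
    have := derM d (el B g) (e (src T g)); rewrite d0 mulr0 addr0.
    by rewrite el_mul mul_vx eqxx.
  rewrite E; apply: co_rmul0 => y; rewrite mul_vx; case: eqP => // sg [yx].
  by move: ne; rewrite sg yx eqxx.
have E : d (el B g) = e (tgt T g) * d (el B g).
  have := derM d (e (tgt T g)) (el B g); rewrite d0 mul0r add0r.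
  by rewrite el_mul vx_mul eqxx.
rewrite E; apply: co_lmul0 => y; rewrite vx_mul; case: eqP => // sg [yx].
by move: ne; rewrite sg yx eqxx.
Qed.

Lemma co_der_vertex g v : gen T g -> co B (vx T v) (d (el B g)) = 0.
Proof.
move=> gg; apply/eqP; apply/negPn/negP => nz.
have [] := co_der_parallel nz; rewrite src_vx tgt_vx => sv tv.
move/negP: nz; apply; apply/eqP/(@co_der_eq0_square _ _ g); first exact: gen_gen.
  by rewrite vx_mul tv eqxx.
by rewrite mul_vx sv eqxx.
Qed.

End Derivation.

Hypothesis nilp : forall d d' g h h', der0 e d -> der0 e d' ->
  gen T g -> gen T h -> gen T h' -> g != h -> h != h' ->
  co B h (d (el B g)) != 0 -> co B h' (d' (el B h)) = 0.

(** These generators get weight 3 and the other ones 2, so that a component of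
    d(g) along a rigid generator raises the weight when g is not rigid. *)
Definition rigid g := `[< forall d, der0 e d ->
  forall h, gen T h -> g != h -> co B h (d (el B g)) = 0 >].

Let G := {g : X | gen T g}.
Let xg (g : G) : C := el B (val g).
Let wt (g : G) : nat := (2 + rigid (val g))%N.
Local Notation filt := (filt xg wt).

Lemma filt2 x : (0 < rk T x)%N -> filt 2 (el B x).
Proof.
elim: (rk T x).+1 {-2}x (ltnSn (rk T x)) => {x}[//|n IH] x.
rewrite ltnS => le r0.
case: (gen_dec r0) => [gx|[y [z [ry rz m]]]].
  by apply: filt_le (filt_gen xg wt (exist _ x gx)); rewrite leq_addr.
have r := rk_mul m.
have -> : el B x = el B y * el B z by rewrite el_mul m.
apply: (@filt_le _ _ _ _ _ 4) => //; apply: (@filt_mul _ _ _ _ _ 2 2).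
  by apply: IH => //; apply: leq_trans le; rewrite r -addn1 leq_add2l.
by apply: IH => //; apply: leq_trans le; rewrite r -add1n leq_add2r.
Qed.

Lemma filt_cases x : [\/ x = vx T (src T x), gen T x | filt 4 (el B x)].
Proof.
case: (posnP (rk T x)) => [/rk0_vx|r0]; first by constructor 1.
case: (gen_dec r0) => [gx|[y [z [ry rz m]]]]; first by constructor 2.
constructor 3; have -> : el B x = el B y * el B z by rewrite el_mul m.
by apply: (@filt_mul _ _ _ _ _ 2 2); exact: filt2.
Qed.

Lemma table_generated (P : C -> Prop) :
  (forall v, P (e v)) -> (forall g, P (xg g)) ->
  (forall a c c', P c -> P c' -> P (a *: c + c')) ->
  (forall c c', P c -> P c' -> P (c * c')) -> forall c, P c.
Proof.
move=> Pe Pg Pl Pm.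
have [v _ | /eq_card0 V0] := pickP (pred_of_simpl (@predT V)); last first.
  move=> c; have /eqP := e_sum; rewrite big1 => [|v]; last first.
    by have := fintype0 v V0.
  by rewrite eq_sym oner_eq0.
have P0 : P 0.
  by have := Pl (-1) _ _ (Pe v) (Pe v); rewrite scaleN1r addNr.
have Px x : P (el B x).
  elim: (rk T x).+1 {-2}x (ltnSn (rk T x)) => {x}[//|n IH] x.
  rewrite ltnS => le; case: (posnP (rk T x)) => [/rk0_vx->|r0]; first exact: Pe.
  case: (gen_dec r0) => [gx|[y [z [ry rz m]]]].
    exact: (Pg (exist _ x gx)).
  have r := rk_mul m.
  have -> : el B x = el B y * el B z by rewrite el_mul m.
  apply: Pm; apply: IH; apply: leq_trans le; rewrite r.
    by rewrite -addn1 leq_add2l.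
  by rewrite -add1n leq_add2r.
move=> c; rewrite (el_span B c).
by elim/big_rec: _ => // x c' _; exact: Pl.
Qed.

Lemma table_triangular d : der0 e d ->
  forall g, exists a, filt (wt g).+1 (d (xg g) - a *: xg g).
Proof.
move=> d0 g; exists (co B (val g) (d (xg g))).
rewrite {1}(el_span B (d (xg g))) (bigD1 (val g)) //= addrAC subrr add0r.
apply: filt_sum => x ne.
have [->|nz] := eqVneq (co B x (d (xg g))) 0.
  by rewrite scale0r; exact: filt_zero.
apply: filtZ; case: (filt_cases x) => [xv|gx|].
- by move: nz; rewrite xv co_der_vertex ?eqxx //; exact: (valP g).
- have ne' : val g != x by rewrite eq_sym.
  have ng : rigid (val g) = false.
    by apply/asboolPn => /(_ d d0 x gx ne') h; rewrite /xg h eqxx in nz.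
  have gd : rigid x = true.
    apply/asboolP => d' d0' h gh xh.
    exact: (nilp d0 d0' (valP g) gx gh ne' xh nz).
  by have := filt_gen xg wt (exist _ x gx); rewrite /wt ng gd.
by apply: filt_le; rewrite /wt; case: rigid.
Qed.

(** Ranks are additive and weights are at most 3, so a term of filtration
    degree i needs rank at least i / 3. *)
Lemma table_nilpotent i c : filt i c ->
  forall x, co B x c != 0 -> (i <= 3 * rk T x)%N.
Proof.
elim=> {i c} [//|g|i j c c' _ IH _ IH'|i|i a c c' _ IH _ IH'|i j c le _ IH] x.
- rewrite co_el; case: (x =P val g) => [->|]; last by rewrite eqxx.
  by move=> _; have := gen_rk (valP g); rewrite /wt; case: rigid;
     case: (rk T (val g)) => // n _; rewrite mulnS ltn_addr.
- case/co_mul_neq0 => y [z [hy hz /rk_mul->]].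
  by rewrite mulnDr leq_add ?IH ?IH'.
- by rewrite linear0 eqxx.
- rewrite linearP /=; have [->|h] := eqVneq (co B x c) 0; last first.
    by move=> _; exact: IH.
  by rewrite mulr0 add0r; exact: IH'.
by move=> h; apply: leq_trans le (IH _ h).
Qed.

Theorem table_solvable : lie_solvable (HH1 C).
Proof.
apply: (solvable_of_filtration (x := xg) (w := wt) e_orth e_sum).
- exact: table_generated.
- exact: table_triangular.
exists (3 * (\max_x rk T x)).+1 => c hc; apply: (@coP _ _ _ _ B) => x.
rewrite linear0; apply/eqP/negPn/negP => /(table_nilpotent hc).
by rewrite ltnNge leq_mul2l leq_bigmax ?orbT.
Qed.

End TableAlgebra.

(** * The multiplicative basis of a trivial extension *)

(** On X + X, inl p stands for the path p and inr p for its dual p*.  The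
    quotients ld p q and rd q p are the r with r p = q and p r = q: they give
    the products p q* = r* and q* p = r*. *)
Definition trivext_mu (X : finType) (mu ld rd : X -> X -> option X)
    (x y : X + X) : option (X + X) :=
  match x, y with
  | inl p, inl q => omap inl (mu p q)
  | inl p, inr q => omap inr (ld p q)
  | inr q, inl p => omap inr (rd q p)
  | inr _, inr _ => None
  end.

Section TrivextBasis.

Variables (K : fieldType) (A : falgType K) (X : finType).
Variables (mu ld rd : X -> X -> option X) (B : mult_basis A mu).
Hypothesis ldP : forall p q r, ld p q = Some r <-> mu r p = Some q.
Hypothesis rdP : forall p q r, rd q p = Some r <-> mu p r = Some q.

Definition dual_el (x : X) : 'Hom(A, K^o) := linfun (co B x : A -> K^o).

Lemma dual_elE x a : dual_el x a = co B x a.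
Proof. by rewrite lfunE. Qed.

Lemma dual_ext (f g : 'Hom(A, K^o)) :
  (forall x, f (el B x) = g (el B x)) -> f = g.
Proof.
move=> h; apply/lfunP => a; rewrite (el_span B a) !linear_sum /=.
by apply: eq_bigr => x _; rewrite !linearZ /= h.
Qed.

Definition trivext_el (x : X + X) : trivext A :=
  match x with inl x => (el B x, 0) | inr x => (0, dual_el x) end.

Definition trivext_co (x : X + X) (a : trivext A) : K :=
  match x with inl x => co B x a.1 | inr x => a.2 (el B x) end.

Fact trivext_co_linear x : linear_for *%R (trivext_co x).
Proof.
case: x => x c a b.
  by rewrite -[LHS]/(co B x (c *: a.1 + b.1)) linearP.
by rewrite -[LHS]/((c *: a.2 + b.2) (el B x)) add_lfunE scale_lfunE.
Qed.

Fact trivext_co_el x y : trivext_co x (trivext_el y) = (x == y)%:R.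
Proof.
case: x y => x [] y /=; rewrite ?linear0 ?zero_lfunE ?co_el //.
by rewrite dual_elE co_el eq_sym.
Qed.

Fact trivext_span a : a = \sum_x trivext_co x a *: trivext_el x.
Proof.
rewrite big_sumType /=; case: a => a f /=.
have E1 (F : X -> K) : \sum_x F x *: ((el B x, 0) : trivext A) =
    (\sum_x F x *: el B x, 0).
  apply: (big_ind2 (fun (u : trivext A) v => u = (v, 0)))
    => // [u v u' v' -> ->|x _].
    by congr (_, _); rewrite /= addr0.
  by congr (_, _); rewrite /= scaler0.
have E2 (F : X -> K) : \sum_x F x *: ((0, dual_el x) : trivext A) =
    (0, \sum_x F x *: dual_el x).
  apply: (big_ind2 (fun (u : trivext A) v => u = (0, v)))
    => // [u v u' v' -> ->|x _].
    by congr (_, _); rewrite /= addr0.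
  by congr (_, _); rewrite /= scaler0.
rewrite E1 E2; congr (_, _) => /=; first by rewrite addr0 -el_span.
rewrite add0r; apply: dual_ext => x; rewrite sum_lfunE (bigD1 x) //=.
rewrite !lfunE /= dual_elE co_el eqxx big1 ?addr0 => [|y ny].
  by rewrite -[RHS]/(_ * _) mulr1.
by rewrite !lfunE /= dual_elE co_el (negbTE ny) -[LHS]/(_ * _) mulr0.
Qed.

Fact trivext_el_mul x y :
  trivext_el x * trivext_el y = oapp trivext_el 0 (trivext_mu mu ld rd x y).
Proof.
case: x y => p [] q /=; rewrite -[LHS]/(trivext_mul _ _) /trivext_mul /=.
- rewrite el_mul; have -> : dual_lact (el B p) 0 + dual_ract 0 (el B q) = 0.
    apply/lfunP => a.
    by rewrite add_lfunE dual_lactE dual_ractE !zero_lfunE addr0.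
  by case: (mu p q).
- rewrite mulr0; have -> : oapp trivext_el 0 (omap inr (ld p q)) =
      (0, oapp dual_el 0 (ld p q)) by case: (ld p q).
  congr (_, _); apply: dual_ext => r.
  rewrite add_lfunE dual_lactE dual_ractE zero_lfunE addr0 dual_elE co_elmul.
  case E: (ld p q) => [s|] /=.
    rewrite dual_elE co_el; congr (_%:R); congr nat_of_bool.
    apply/eqP/eqP => [/ldP|<-]; first by rewrite E => -[].
    by apply/ldP.
  by rewrite zero_lfunE; case: eqP => // /ldP; rewrite E.
- rewrite mul0r; have -> : oapp trivext_el 0 (omap inr (rd p q)) =
      (0, oapp dual_el 0 (rd p q)) by case: (rd p q).
  congr (_, _); apply: dual_ext => r.
  rewrite add_lfunE dual_lactE dual_ractE zero_lfunE add0r dual_elE co_elmul.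
  case E: (rd p q) => [s|] /=.
    rewrite dual_elE co_el; congr (_%:R); congr nat_of_bool.
    apply/eqP/eqP => [/rdP|<-]; first by rewrite E => -[].
    by apply/rdP.
  by rewrite zero_lfunE; case: eqP => // /rdP; rewrite E.
rewrite mul0r; congr (_, _); apply/lfunP => a.
rewrite add_lfunE dual_lactE dual_ractE mulr0 mul0r.
by rewrite !linear0 zero_lfunE addr0.
Qed.

Definition trivext_basis : mult_basis (trivext A) (trivext_mu mu ld rd) :=
  MultBasis trivext_co_linear trivext_co_el trivext_span trivext_el_mul.

End TrivextBasis.

(** What remains of the gentle axioms on the level of paths: two paths that
    overlap in a non-trivial path glue ([mul_overlap]); two continuations of a
    non-trivial path on one side are comparable ([fork_left], [fork_right]); the
    first and the last arrow of a path are unique. *)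
Record string_table (V X : finType) (T : table V X) : Prop := StringTable {
  gen_rk1 : forall g, gen T g -> rk T g = 1%N;
  mul_overlap : forall r k a m z, (0 < rk T k)%N ->
    mul T r k = Some m -> mul T k a = Some z ->
    (exists u, mul T m a = Some u) /\ (exists u, mul T r z = Some u);
  fork_left : forall y r r' m n, (0 < rk T y)%N ->
    mul T r y = Some m -> mul T r' y = Some n ->
    (exists s, mul T s m = Some n) \/ (exists s, mul T s n = Some m);
  fork_right : forall y r r' m n, (0 < rk T y)%N ->
    mul T y r = Some m -> mul T y r' = Some n ->
    (exists s, mul T m s = Some n) \/ (exists s, mul T n s = Some m);
  first_gen : forall a b y k z, gen T a -> gen T b ->
    mul T k a = Some z -> mul T y b = Some z -> a = b;
  last_gen : forall a b y k z, gen T a -> gen T b ->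
    mul T a k = Some z -> mul T b y = Some z -> a = b
}.

Definition maximal (V X : finType) (T : table V X) (m : X) :=
  [forall y, (0 < rk T y)%N ==> (mul T y m == None) && (mul T m y == None)].

Section TrivextTable.

Variables (V X : finType) (T : table V X).
Implicit Types (p q r : X).

Definition ldiv p q := [pick r | mul T r p == Some q].
Definition rdiv q p := [pick r | mul T p r == Some q].

Lemma ldivP p q r : ldiv p q = Some r <-> mul T r p = Some q.
Proof.
rewrite /ldiv; case: pickP => [s /eqP m|n]; last by split=> // /eqP; rewrite n.
by split=> [[<-]//|m']; rewrite (mul_injr m m').
Qed.

Lemma rdivP p q r : rdiv q p = Some r <-> mul T p r = Some q.
Proof.
rewrite /rdiv; case: pickP => [s /eqP m|n]; last by split=> // /eqP; rewrite n.
by split=> [[<-]//|m']; rewrite (mul_injl m m').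
Qed.

Lemma maximalP m : reflect
  (forall y, (0 < rk T y)%N -> mul T y m = None /\ mul T m y = None)
  (maximal T m).
Proof.
apply: (iffP forallP) => h y.
  by move=> ry; have := h y; rewrite ry => /andP[/eqP-> /eqP->].
by apply/implyP => /h[-> ->].
Qed.

Definition trivext_mul_table := trivext_mu (mul T) ldiv rdiv.
Local Notation tm := trivext_mul_table.

Lemma tm_lr p q r : tm (inl p) (inr q) = Some (inr r) <-> mul T r p = Some q.
Proof.
rewrite -ldivP /tm /=; case: (ldiv p q) => //= s.
by split=> [[->]|[->]].
Qed.

Lemma tm_rl p q r : tm (inr q) (inl p) = Some (inr r) <-> mul T p r = Some q.
Proof.
rewrite -rdivP /tm /=; case: (rdiv q p) => //= s.
by split=> [[->]|[->]].
Qed.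

Lemma tm_ll p q r : tm (inl p) (inl q) = Some (inl r) <-> mul T p q = Some r.
Proof.
rewrite /tm /=; case: (mul T p q) => //= s.
by split=> [[->]|[->]].
Qed.

Lemma tmP x y z : tm x y = Some z ->
  [\/ exists p q r, [/\ x = inl p, y = inl q, z = inl r & mul T p q = Some r],
      exists p q r, [/\ x = inl p, y = inr q, z = inr r & mul T r p = Some q]
    | exists p q r, [/\ x = inr q, y = inl p, z = inr r & mul T p r = Some q] ].
Proof.
case: x y z => p [] q [] r // h.
- by constructor 1; exists p, q, r; split=> //; exact/tm_ll.
- by move: h => /=; case: mul.
- by move: h => /=; case: ldiv.
- by constructor 2; exists p, q, r; split=> //; exact/tm_lr.
- by move: h => /=; case: rdiv.
by constructor 3; exists q, p, r; split=> //; exact/tm_rl.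
Qed.

Definition tvx v : X + X := inl (vx T v).
Definition tsrc (x : X + X) :=
  match x with inl p => src T p | inr p => tgt T p end.
Definition ttgt (x : X + X) :=
  match x with inl p => tgt T p | inr p => src T p end.
(** The rank of p* is counted down from an upper bound for the ranks of the
    paths, so that p q* = r* with q = r p is compatible with the grading, and it
    stays positive. *)
Definition trk (x : X + X) :=
  match x with inl p => rk T p | inr p => ((\max_q rk T q).+1 - rk T p)%N end.

(** TA is generated by the generators of A and the duals of the maximal paths:
    the dual of a proper subpath of m is obtained from m* by multiplication. *)
Definition tgen (x : X + X) :=
  match x with inl p => gen T p | inr p => maximal T p end.

Lemma rk_le p : (rk T p <= (\max_q rk T q).+1)%N.
Proof. by rewrite ltnW // ltnS leq_bigmax. Qed.

Fact tmul_vx x v : tm x (tvx v) = if v == tsrc x then Some x else None.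
Proof.
case: x => p /=; first by rewrite mul_vx; case: eqP.
case E: (rdiv p (vx T v)) => [r|] /=.
  move/rdivP: E; rewrite vx_mul; case: eqP => // -> [->].
  by rewrite eqxx.
case: eqP => // ev; suff : rdiv p (vx T v) = Some p by rewrite E.
by apply/rdivP; rewrite vx_mul ev eqxx.
Qed.

Fact tvx_mul x v : tm (tvx v) x = if v == ttgt x then Some x else None.
Proof.
case: x => p /=; first by rewrite vx_mul; case: eqP.
case E: (ldiv (vx T v) p) => [r|] /=.
  move/ldivP: E; rewrite mul_vx; case: eqP => // -> [->].
  by rewrite eqxx.
case: eqP => // ev; suff : ldiv (vx T v) p = Some p by rewrite E.
by apply/ldivP; rewrite mul_vx ev eqxx.
Qed.

Fact trk_mul x y z : tm x y = Some z -> trk z = (trk x + trk y)%N.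
Proof.
case/tmP => -[p [q [r [-> -> -> /rk_mul m]]]] /=; first exact: m.
  by rewrite m [RHS]addnC subnDA subnK // leq_subRL ?rk_le // -m rk_le.
rewrite m [(rk T p + _)%N]addnC subnDA subnK //.
by rewrite leq_subRL ?rk_le // addnC -m rk_le.
Qed.

Fact trk0_vx x : trk x = 0%N -> x = tvx (tsrc x).
Proof.
case: x => p /=; first by move/rk0_vx => {1}->.
by move/eqP; rewrite subn_eq0 ltnNge leq_bigmax.
Qed.

Fact tmul_injl x y y' z : tm x y = Some z -> tm x y' = Some z -> y = y'.
Proof.
case/tmP => -[p [q [r [-> -> -> m]]]];
  case/tmP => -[p' [q' [r' [[e1] e2 [e3] m']]]] //;
  rewrite e2; congr (_ _); subst.
- exact: mul_injl m m'.
- by move: m'; rewrite m => -[].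
exact: mul_injr m m'.
Qed.

Fact tmul_injr x x' y z : tm x y = Some z -> tm x' y = Some z -> x = x'.
Proof.
case/tmP => -[p [q [r [-> -> -> m]]]];
  case/tmP => -[p' [q' [r' [e2 [e1] [e3] m']]]] //;
  rewrite e2; congr (_ _); subst.
- exact: mul_injr m m'.
- exact: mul_injl m m'.
by move: m'; rewrite m => -[].
Qed.

Fact tgen_rk g : tgen g -> (0 < trk g)%N.
Proof.
case: g => p /=; first exact: gen_rk.
by rewrite subn_gt0 ltnS leq_bigmax.
Qed.

Fact tgen_gen g : tgen g -> tm g g = None.
Proof. by case: g => p //= /gen_gen ->. Qed.

Lemma trkr_gt0 p : (0 < trk (inr p))%N.
Proof. by rewrite /= subn_gt0 ltnS leq_bigmax. Qed.

Fact tgen_dec x : (0 < trk x)%N -> tgen x \/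
  exists y z, [/\ (0 < trk y)%N, (0 < trk z)%N & tm y z = Some x].
Proof.
case: x => p /= rp.
  case: (gen_dec rp) => [|[y [z [ry rz m]]]]; [by left | right].
  by exists (inl y), (inl z); split=> //; exact/tm_ll.
case: (boolP (maximal T p)) => [|/forallPn[y]]; first by left.
rewrite negb_imply negb_and => /andP[ry /orP[]] h; right.
  case m: (mul T y p) h => [q|] // _.
  by exists (inr q), (inl y); rewrite trkr_gt0; split=> //; exact/tm_rl.
case m: (mul T p y) h => [q|] // _.
by exists (inl y), (inr q); rewrite trkr_gt0; split=> //; exact/tm_lr.
Qed.

Definition trivext_table : table V (X + X)%type :=
  Table tmul_vx tvx_mul (src_vx T) (tgt_vx T) trk_mul trk0_vx
    tmul_injl tmul_injr tgen_rk tgen_gen tgen_dec.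

End TrivextTable.

(** * Derivations of string tables and of their trivial extensions *)

Section StringTable.

Variables (V X : finType) (T : table V X) (S : string_table T).

Lemma mul_rk0l x y z : rk T x = 0%N -> mul T x y = Some z -> z = y.
Proof.
by move/rk0_vx=> ->; rewrite vx_mul; case: eqP => // _ [->].
Qed.

Lemma mul_rk0r x y z : rk T x = 0%N -> mul T y x = Some z -> z = y.
Proof.
by move/rk0_vx=> ->; rewrite mul_vx; case: eqP => // _ [->].
Qed.

Lemma gen_right a b k m n : gen T a -> gen T b -> (0 < rk T k)%N ->
  mul T k a = Some m -> mul T k b = Some n -> a = b.
Proof.
move=> ga gb rk0 ma mb.
have [rm rn] : rk T m = (rk T k).+1 /\ rk T n = (rk T k).+1.
  by rewrite (rk_mul ma) (rk_mul mb) (gen_rk1 S ga) (gen_rk1 S gb) addn1.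
have mn : m = n.
  case: (fork_right S rk0 ma mb) => -[s ms]; have := rk_mul ms;
    rewrite rm rn => /eqP; rewrite -[X in X == _]addn0 eqn_add2l eq_sym => /eqP s0.
    by rewrite (mul_rk0r s0 ms).
  by rewrite (mul_rk0r s0 ms).
by move: ma; rewrite mn => /mul_injl; apply.
Qed.

Lemma gen_left a b k m n : gen T a -> gen T b -> (0 < rk T k)%N ->
  mul T a k = Some m -> mul T b k = Some n -> a = b.
Proof.
move=> ga gb rk0 ma mb.
have [rm rn] : rk T m = (rk T k).+1 /\ rk T n = (rk T k).+1.
  by rewrite (rk_mul ma) (rk_mul mb) (gen_rk1 S ga) (gen_rk1 S gb) !add1n.
have mn : m = n.
  case: (fork_left S rk0 ma mb) => -[s ms]; have := rk_mul ms;
    rewrite rm rn => /eqP; rewrite -[X in X == _]add0n eqn_add2r eq_sym => /eqP s0.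
    by rewrite (mul_rk0l s0 ms).
  by rewrite (mul_rk0l s0 ms).
by move: ma; rewrite mn => /mul_injr; apply.
Qed.

Lemma maximal_l m y z : maximal T m -> mul T y m = Some z -> rk T y = 0%N.
Proof.
by move/maximalP => h; case: (posnP (rk T y)) => // /h[->].
Qed.

Lemma maximal_r m y z : maximal T m -> mul T m y = Some z -> rk T y = 0%N.
Proof.
by move/maximalP => h; case: (posnP (rk T y)) => // /h[_ ->].
Qed.

Lemma maximal_left_eq y r r' m n :
  (0 < rk T y)%N -> maximal T m -> maximal T n ->
  mul T r y = Some m -> mul T r' y = Some n -> m = n.
Proof.
move=> ry mm mn em en; case: (fork_left S ry em en) => -[s ms].
  by rewrite (mul_rk0l (maximal_l mm ms) ms).
by rewrite (mul_rk0l (maximal_l mn ms) ms).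
Qed.

Lemma maximal_right_eq y r r' m n :
  (0 < rk T y)%N -> maximal T m -> maximal T n ->
  mul T y r = Some m -> mul T y r' = Some n -> m = n.
Proof.
move=> ry mm mn em en; case: (fork_right S ry em en) => -[s ms].
  by rewrite (mul_rk0r (maximal_r mm ms) ms).
by rewrite (mul_rk0r (maximal_r mn ms) ms).
Qed.

Lemma maximal_no_right r k a m z :
  (0 < rk T k)%N -> (0 < rk T a)%N -> maximal T m ->
  mul T r k = Some m -> mul T k a <> Some z.
Proof.
move=> rk ra mm e1 e2; have [[u eu] _] := mul_overlap S rk e1 e2.
by move: ra; rewrite (maximal_r mm eu).
Qed.

Lemma maximal_no_left r k a m z :
  (0 < rk T k)%N -> (0 < rk T r)%N -> maximal T m ->
  mul T k a = Some m -> mul T r k <> Some z.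
Proof.
move=> rk rr mm e1 e2; have [_ [u eu]] := mul_overlap S rk e2 e1.
by move: rr; rewrite (maximal_l mm eu).
Qed.

Variable K : fieldType.
Hypothesis two_neq0 : 2%:R != 0 :> K.

Section Base.

Variables (A : falgType K) (B : mult_basis A (mul T)).

(** If h can be continued, by k h say, then k g = 0 for every other generator
    g, and k h does not start with g. *)
Lemma gen_der_maximal (d : der A) g h : gen T g -> gen T h -> g != h ->
  co B h (d (el B g)) != 0 -> maximal T h.
Proof.
move=> gg gh gNh nz; apply/maximalP => k rk_gt0; split.
  case kh: (mul T k h) => [z|] //; case/eqP: nz.
  apply: (co_der_eq0_left _ _ kh) => [|y yg].
    case kg: (mul T k g) => [t|] //.
    by rewrite (gen_right gg gh rk_gt0 kg kh) eqxx in gNh.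
  by rewrite (first_gen S gg gh yg kh) eqxx in gNh.
case hk: (mul T h k) => [z|] //; case/eqP: nz.
apply: (co_der_eq0_right _ _ hk) => [|y gy].
  case gk: (mul T g k) => [t|] //.
  by rewrite (gen_left gg gh rk_gt0 gk hk) eqxx in gNh.
by rewrite (last_gen S gg gh gy hk) eqxx in gNh.
Qed.

Hypothesis no_parallel : forall a b, gen T a -> gen T b -> a != b ->
  maximal T a -> maximal T b ->
  ~ (src T a = src T b /\ tgt T a = tgt T b).

Theorem string_solvable : lie_solvable (HH1 A).
Proof.
apply: (table_solvable (B := B) two_neq0)
  => d d' g h h' d0 d0' gg gh gh' gNh hNh' nz.
apply/eqP/negPn/negP => nz'.
have [es et] := co_der_parallel d0' nz'.
by apply: (no_parallel gh gh' hNh') => //; [exact: gen_der_maximal nz|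
  exact: gen_der_maximal nz'].
Qed.

End Base.

Section Trivext.

Variables (C : falgType K) (B : mult_basis C (mul (trivext_table T))).
Let TT := trivext_table T.

(** As in [gen_der_maximal], one multiplies h by a path k.  If h is an arrow
    that can be continued, k is a continuation.  If h is the dual of a maximal
    path m = r k with r and k non-trivial, then k h = r*.  As m is maximal, and
    the only maximal path that starts with k or ends with r, the other
    generators are killed by k and do not have r* as a left multiple. *)
Lemma tgen_der_arrow (d : der C) g h : der0 (fun v => el B (vx TT v)) d ->
  gen TT g -> gen TT h -> g != h -> co B h (d (el B g)) != 0 ->
  exists a, [/\ gen T a, maximal T a & h = inl a \/ h = inr a].
Proof.
move=> d0 gg gh gNh nz; have [es et] := co_der_parallel d0 nz.
case: h => h in gh gNh nz es et *.
  exists h; split=> //; last by left.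
  apply/maximalP => k rk_gt0; split.
    case kh: (mul T k h) => [z|] //; case/eqP: nz.
    have KH : mul TT (inl k) (inl h) = Some (inl z) by exact/tm_ll.
    apply: (co_der_eq0_left _ _ KH) => [|y yg].
      case kg: (mul TT (inl k) g) => [t|] //.
      case/tmP: kg => -[p [q [r [[e1] e2 _ m]]]] //; subst.
        by rewrite (gen_right gg gh rk_gt0 m kh) eqxx in gNh.
      by case: (maximal_no_right rk_gt0 (gen_rk gh) gg m kh).
    case/tmP: yg => -[p [q [r [e1 e2 [e3] m]]]] //; subst.
    by rewrite (first_gen S gg gh m kh) eqxx in gNh.
  case hk: (mul T h k) => [z|] //; case/eqP: nz.
  have HK : mul TT (inl h) (inl k) = Some (inl z) by exact/tm_ll.
  apply: (co_der_eq0_right _ _ HK) => [|y gy].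
    case gk: (mul TT g (inl k)) => [t|] //.
    case/tmP: gk => -[p [q [r [e1 [e2] _ m]]]] //; subst.
      by rewrite (gen_left gg gh rk_gt0 m hk) eqxx in gNh.
    by case: (maximal_no_left rk_gt0 (gen_rk gh) gg m hk).
  case/tmP: gy => -[p [q [r [e1 e2 [e3] m]]]] //; subst.
  by rewrite (last_gen S gg gh m hk) eqxx in gNh.
exists h; split=> //; last by right.
case: (posnP (rk T h)) => [r0|rh].
  have hv := rk0_vx r0; have sh : src T h = tgt T h by rewrite hv src_vx tgt_vx.
  exfalso; case: g => g in gg gNh nz es et *.
    have : (0 < rk T g)%N := gen_rk gg; rewrite (@maximal_l h g g gh) //.
    by rewrite hv mul_vx sh -[src T g]es eqxx.
  have hg : mul T h g = Some g.
    by rewrite hv vx_mul sh -[tgt T g]es eqxx.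
  have := mul_rk0r (maximal_r gh hg) hg => gh'.
  by rewrite gh' eqxx in gNh.
case: (gen_dec rh) => // -[r [y [rr ry m]]]; case/eqP: nz.
have YH : mul TT (inl y) (inr h) = Some (inr r) by exact/tm_lr.
apply: (co_der_eq0_left _ _ YH) => [|x xg].
  case yg: (mul TT (inl y) g) => [t|] //.
  case/tmP: yg => -[p [q [s [[e1] e2 _ m']]]] //; subst.
    by case: (maximal_no_right ry (gen_rk gg) gh m m').
  by rewrite (maximal_left_eq ry gg gh m' m) eqxx in gNh.
case/tmP: xg => -[p [q [s [e1 e2 [e3] m']]]] //; subst.
  by rewrite (maximal_right_eq rr gg gh m' m) eqxx in gNh.
by case: (maximal_no_left rr (gen_rk gg) gh m m').
Qed.

Hypothesis no_parallel : forall a b, gen T a -> gen T b -> a != b ->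
  maximal T a -> maximal T b ->
  ~ ((src T a = src T b /\ tgt T a = tgt T b) \/
     (src T a = tgt T b /\ tgt T a = src T b)).

(** The exchange of an isolated loop with its dual is excluded by
    [co_der_eq0_square], as a a* = a* a is the dual of a trivial path. *)
Theorem trivext_solvable : lie_solvable (HH1 C).
Proof.
apply: (table_solvable (B := B) two_neq0)
  => d d' g h h' d0 d0' gg gh gh' gNh hNh' nz.
apply/eqP/negPn/negP => nz'.
have [es et] := co_der_parallel d0' nz'.
have [a [ga ma ha]] := tgen_der_arrow d0 gg gh gNh nz.
have [b [gb mb hb]] := tgen_der_arrow d0' gh gh' hNh' nz'.
have [ab|aNb] := eqVneq a b; last first.
  by apply: (no_parallel ga gb aNb ma mb);
    case: ha hb es et => -> [->|->] /= -> ->; [left|right|right|left].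
subst b; case/eqP: nz'.
have LR : mul TT (inl a) (inr a) = Some (inr (vx T (tgt T a))).
  by apply/tm_lr; rewrite vx_mul eqxx.
have RL : mul TT (inr a) (inl a) = Some (inr (vx T (src T a))).
  by apply/tm_rl; rewrite mul_vx eqxx.
case: ha hb hNh' es et => -> [->|->] /=; rewrite ?eqxx // => _ es et.
  rewrite es in LR.
  exact: (co_der_eq0_square B two_neq0 d' (gen_gen (ga : gen TT (inl a))) RL LR).
rewrite -es in LR.
exact: (co_der_eq0_square B two_neq0 d' (gen_gen (ma : gen TT (inr a))) LR RL).
Qed.

End Trivext.
End StringTable.

(** * The table of the relation-free paths *)

Lemma cat_injr (T : Type) (t s s' : seq T) : t ++ s = t ++ s' -> s = s'.
Proof. by move/(congr1 (drop (size t))); rewrite !drop_size_cat. Qed.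

Lemma cat_injl (T : Type) (t s s' : seq T) : s ++ t = s' ++ t -> s = s'.
Proof.
move=> e; have es : size s = size s'.
  by apply: (@addIn (size t)); rewrite -!size_cat e.
by move/(congr1 (take (size s))): e; rewrite {2}es !take_size_cat.
Qed.

Section SortedWords.

Variables (T : eqType) (r : rel T).

Lemma sorted_overlap (s c t : seq T) : c != [::] ->
  sorted r (s ++ c) -> sorted r (c ++ t) -> sorted r (s ++ c ++ t).
Proof.
case: c => // a c _; case: s => //= b s.
by rewrite !cat_path /= cat_path => /and3P[-> -> ->] /andP[_ ->].
Qed.

Lemma not_sorted (s : seq T) : ~~ sorted r s ->
  exists s1 a b s2, s = s1 ++ [:: a, b & s2] /\ ~~ r a b.
Proof.
elim: s => [|a [|b s] IH] //.
rewrite [sorted _ _]/= negb_and => /orP[ab|ns].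
  by exists [::], a, b, s.
by have [s1 [c [d [s2 [-> cd]]]]] := IH ns; exists (a :: s1), c, d, s2.
Qed.

Lemma path_prefix a s t : (forall a b c, r a b -> r a c -> b = c) ->
  path r a s -> path r a t ->
  (exists u, t = s ++ u) \/ (exists u, s = t ++ u).
Proof.
move=> fr; elim: s t a => [|b s IH] [|c t] a /=.
- by left; exists [::].
- by left; exists (c :: t).
- by right; exists (b :: s).
case/andP=> ab ps /andP[ac pt]; have bc := fr _ _ _ ab ac; subst c.
by case: (IH _ _ ps pt) => -[u ->]; [left|right]; exists u.
Qed.

Lemma sorted_prefix c s t : (forall a b c, r a b -> r a c -> b = c) ->
  c != [::] -> sorted r (c ++ s) -> sorted r (c ++ t) ->
  (exists u, t = s ++ u) \/ (exists u, s = t ++ u).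
Proof.
case: c => // a c fr _ /=; rewrite !cat_path => /andP[_ ps] /andP[_ pt].
exact: path_prefix ps pt.
Qed.

End SortedWords.

Lemma sorted_suffix (T : eqType) (r : rel T) c s t :
  (forall a b c, r b a -> r c a -> b = c) ->
  c != [::] -> sorted r (s ++ c) -> sorted r (t ++ c) ->
  (exists u, t = u ++ s) \/ (exists u, s = u ++ t).
Proof.
move=> fr c0; rewrite -(revK (s ++ c)) rev_sorted rev_cat.
rewrite -(revK (t ++ c)) rev_sorted rev_cat.
move=> hs ht; have c0' : rev c != [::] by rewrite -size_eq0 size_rev size_eq0.
have [] := sorted_prefix _ c0' hs ht; first by move=> a b d; apply: fr.
  by case=> u /(congr1 rev); rewrite rev_cat !revK => ->; left; exists (rev u).
by case=> u /(congr1 rev); rewrite rev_cat !revK => ->; right; exists (rev u).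
Qed.

Section PathTable.

Variables (Q : quiver) (nr : rel (arrow Q)) (L : seq (qpath Q)).
Hypothesis LP : forall p, (p \in L) = sorted nr (parrows p).

Local Notation X := (seq_sub L).
Implicit Types (x y z : X) (v : vertex Q) (s t : seq (arrow Q)).

Definition psrc x := psource (val x).
Definition ptgt x := ptarget (val x).
Definition arrs_of x := parrows (val x).
Definition plen x := size (arrs_of x).
Definition path_mu x y : option X := obind insub (Defs.pcomp (val x) (val y)).

Lemma arrs_sorted x : sorted nr (arrs_of x).
Proof. by rewrite -LP; exact: valP x. Qed.

Lemma arrs_walk x : is_walk (psrc x) (arrs_of x).
Proof. exact: valP (val x). Qed.

Lemma seq_sub_path_eq x y : psrc x = psrc y -> arrs_of x = arrs_of y -> x = y.
Proof.
move=> es ea; apply: val_inj; apply: val_inj.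
by apply/eqP; rewrite -pair_eqE /=; apply/andP; split; apply/eqP.
Qed.

Lemma ptgtE x : ptgt x = last (psrc x) [seq target a | a <- arrs_of x].
Proof. by []. Qed.

Lemma path_muP x y z : path_mu x y = Some z <->
  [/\ ptgt y = psrc x, psrc z = psrc y & arrs_of z = arrs_of y ++ arrs_of x].
Proof.
rewrite /path_mu; split.
  case E: Defs.pcomp => [p|] //=; case: insubP => // u _ up [<-].
  case/pcomp_someP: E => e1 e2; split=> //.
    by rewrite /psrc up /psource e2.
  by rewrite /arrs_of up /parrows e2.
case=> e1 e2 e3; have [p pp] := pcomp_ex e1; rewrite pp /=.
case/pcomp_someP: pp => _ vp; have -> : p = val z; last by rewrite valK.
apply: val_inj; rewrite vp; apply/eqP; rewrite -pair_eqE /=.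
by apply/andP; split; apply/eqP.
Qed.

Lemma path_mu_tgt x y z : path_mu x y = Some z -> ptgt z = ptgt x.
Proof.
by case/path_muP=> e1 e2 e3; rewrite ptgtE e3 e2 map_cat last_cat -ptgtE e1.
Qed.

Lemma ex_path v s : is_walk v s -> sorted nr s ->
  exists x, psrc x = v /\ arrs_of x = s.
Proof.
move=> w so; have pL : @QPath Q (v, s) w \in L by rewrite LP.
by exists (SeqSub pL).
Qed.

Lemma path_mu_ex x y : ptgt y = psrc x -> sorted nr (arrs_of y ++ arrs_of x) ->
  exists z, path_mu x y = Some z.
Proof.
move=> e so; have w : is_walk (psrc y) (arrs_of y ++ arrs_of x).
  by rewrite is_walk_cat arrs_walk -ptgtE e arrs_walk.
by have [z [e1 e2]] := ex_path w so; exists z; apply/path_muP; split.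
Qed.

Fact trivial_path_mem v : trivial_path v \in L.
Proof. by rewrite LP. Qed.

Definition pvx v : X := SeqSub (trivial_path_mem v).

Fact path_mu_vx x v : path_mu x (pvx v) = if v == psrc x then Some x else None.
Proof.
case: eqP => [->|ne]; first exact/path_muP.
by case E: path_mu => [z|] //; case/path_muP: E => /ne.
Qed.

Fact path_vx_mu x v : path_mu (pvx v) x = if v == ptgt x then Some x else None.
Proof.
case: eqP => [->|ne]; first by apply/path_muP; rewrite /arrs_of cats0.
by case E: path_mu => [z|] //; case/path_muP: E => /esym /ne.
Qed.

Fact plen_mu x y z : path_mu x y = Some z -> plen z = (plen x + plen y)%N.
Proof. by case/path_muP=> _ _ e; rewrite /plen e size_cat addnC. Qed.

Fact plen0_vx x : plen x = 0%N -> x = pvx (psrc x).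
Proof. by move/size0nil => e; apply: seq_sub_path_eq. Qed.

Lemma walk_source v a s : is_walk v (a :: s) -> v = source a.
Proof. by case/andP=> /eqP. Qed.

Lemma arrs_inj x y : (0 < plen x)%N -> arrs_of x = arrs_of y -> x = y.
Proof.
move=> lx e; apply: seq_sub_path_eq => //.
have := arrs_walk x; have := arrs_walk y; rewrite -e /plen in lx *.
by case: (arrs_of x) lx => // a s _ /walk_source -> /walk_source ->.
Qed.

Fact path_mu_injl x y y' z :
  path_mu x y = Some z -> path_mu x y' = Some z -> y = y'.
Proof.
case/path_muP=> _ e1 e2 /path_muP[_ e1' e2'].
apply: seq_sub_path_eq; first by rewrite -e1 e1'.
by apply: (cat_injl (t := arrs_of x)); rewrite -e2 -e2'.
Qed.

Fact path_mu_injr x x' y z :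
  path_mu x y = Some z -> path_mu x' y = Some z -> x = x'.
Proof.
case/path_muP=> e _ e2 /path_muP[e' _ e2'].
apply: seq_sub_path_eq; first by rewrite -e e'.
by apply: (cat_injr (t := arrs_of y)); rewrite -e2 -e2'.
Qed.

Definition parrow x := plen x == 1%N.

Fact parrow_rk x : parrow x -> (0 < plen x)%N.
Proof. by move/eqP->. Qed.

Lemma parrowP x :
  reflect (exists a, arrs_of x = [:: a] /\ psrc x = source a) (parrow x).
Proof.
apply: (iffP eqP) => [|[a [e _]]]; last by rewrite /plen e.
rewrite /plen; have := arrs_walk x; case: (arrs_of x) => [//|a [|//]] w _.
by exists a; rewrite (walk_source w).
Qed.

Hypothesis nr_comp : forall a b, nr a b -> target a = source b.

(** Otherwise all powers of the loop would be among the finitely many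
    relation-free paths. *)
Lemma nr_loopN a : ~~ nr a a.
Proof.
apply/negP => aa; have := nr_comp aa => ta.
have w n : is_walk (source a) (nseq n a).
  by elim: n => //= n; rewrite ta eqxx.
have so n : sorted nr (nseq n a).
  by case: n => //= n; elim: n => //= n ->; rewrite aa.
have [x [_ ex]] := ex_path (w (\max_x plen x).+1) (so (\max_x plen x).+1).
have := leq_bigmax (F := plen) x; rewrite {1}/plen ex size_nseq.
by rewrite ltnn.
Qed.

Fact parrow_sq x : parrow x -> path_mu x x = None.
Proof.
case/parrowP=> a [ea _]; case E: path_mu => [z|] //.
case/path_muP: E => _ _ ez; have := arrs_sorted z.
by rewrite ez ea /= andbT (negbTE (nr_loopN a)).
Qed.

Fact path_dec x : (0 < plen x)%N -> parrow x \/
  exists y z, [/\ (0 < plen y)%N, (0 < plen z)%N & path_mu y z = Some x].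
Proof.
rewrite /parrow /plen.
case ex: (arrs_of x) => [|a [|b s]] // _; [by left | right].
have w := arrs_walk x; have so := arrs_sorted x.
rewrite ex -cat1s is_walk_cat in w; rewrite ex in so; case/andP: w => w1 w2.
have [y [sy ey]] := ex_path w2 (path_sorted so).
have [z [sz ez]] := ex_path w1 (isT : sorted nr [:: a]).
exists y, z; rewrite ey ez; split=> //; apply/path_muP.
by rewrite ptgtE sz ez sy ey ex.
Qed.

Definition path_table : table (vertex Q) X :=
  Table path_mu_vx path_vx_mu (fun=> erefl) (fun=> erefl) plen_mu plen0_vx
    path_mu_injl path_mu_injr parrow_rk parrow_sq path_dec.

Lemma path_split_left x y t : psrc y = psrc x -> arrs_of y = arrs_of x ++ t ->
  exists z, path_mu z x = Some y.
Proof.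
move=> es e; have w := arrs_walk y; have so := arrs_sorted y.
rewrite e is_walk_cat es in w; rewrite e in so; case/andP: w => _ w.
have [z [sz ez]] := ex_path w (cat_sorted2 so).2.
by exists z; apply/path_muP; rewrite sz ez.
Qed.

Lemma path_split_right x y t : (0 < plen x)%N -> arrs_of y = t ++ arrs_of x ->
  exists z, path_mu x z = Some y.
Proof.
move=> lx e; have w := arrs_walk y; have so := arrs_sorted y.
rewrite e is_walk_cat in w; rewrite e in so; case/andP: w => w w'.
have [z [sz ez]] := ex_path w (cat_sorted2 so).1.
exists z; apply/path_muP; rewrite sz ez; split=> //.
rewrite ptgtE sz ez; have := arrs_walk x; move: lx w'; rewrite /plen.
by case: (arrs_of x) => // a s _ /walk_source -> /walk_source ->.
Qed.

Hypothesis nr_next : forall a b c, nr a b -> nr a c -> b = c.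
Hypothesis nr_prev : forall a b c, nr b a -> nr c a -> b = c.

Lemma path_table_string : string_table path_table.
Proof.
split.
- by move=> g /eqP.
- move=> r k a m z lk /path_muP[e1 e2 e3] /path_muP[e4 e5 e6].
  have so : sorted nr (arrs_of a ++ arrs_of k ++ arrs_of r).
    apply: sorted_overlap; rewrite -?e3 -?e6 ?arrs_sorted //.
    by move: lk; rewrite /= /plen; case: arrs_of.
  split; apply: path_mu_ex.
  - by rewrite e4 e2.
  - by rewrite e3.
  - by rewrite (path_mu_tgt (x := k) (y := a)) //; apply/path_muP.
  by rewrite e6 -catA.
- move=> y r r' m n ly /path_muP[e1 e2 e3] /path_muP[e4 e5 e6].
  have y0 : arrs_of y != [::] by move: ly; rewrite /= /plen; case: arrs_of.
  have [] := sorted_prefix nr_next y0 (s := arrs_of r) (t := arrs_of r');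
    rewrite -?e3 -?e6 ?arrs_sorted //.
    case=> u eu; left; apply: (path_split_left (t := u)).
      by rewrite e5 e2.
    by rewrite e6 eu catA -e3.
  case=> u eu; right; apply: (path_split_left (t := u)).
    by rewrite e5 e2.
  by rewrite e3 eu catA -e6.
- move=> y r r' m n ly /path_muP[e1 e2 e3] /path_muP[e4 e5 e6].
  have y0 : arrs_of y != [::] by move: ly; rewrite /= /plen; case: arrs_of.
  have lm : (0 < plen m)%N by rewrite /plen e3 size_cat ltn_addl.
  have ln : (0 < plen n)%N by rewrite /plen e6 size_cat ltn_addl.
  have [] := sorted_suffix nr_prev y0 (s := arrs_of r) (t := arrs_of r');
    rewrite -?e3 -?e6 ?arrs_sorted //.
    case=> u eu; left; apply: (path_split_right (t := u)) => //.
    by rewrite e6 eu -catA -e3.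
  case=> u eu; right; apply: (path_split_right (t := u)) => //.
  by rewrite e3 eu -catA -e6.
- move=> a b y k z /parrowP[a' [ea sa]] /parrowP[b' [eb sb]].
  case/path_muP=> _ _ ez /path_muP[_ _]; rewrite ez ea eb => -[ab _].
  by apply: seq_sub_path_eq; rewrite ?sa ?sb ?ea ?eb ab.
move=> a b y k z /parrowP[a' [ea sa]] /parrowP[b' [eb sb]].
case/path_muP=> _ _ ez /path_muP[_ _].
rewrite ez ea eb !cats1 => /rcons_inj[_ ab].
by apply: seq_sub_path_eq; rewrite ?sa ?sb ?ea ?eb ab.
Qed.

End PathTable.

(** * Quotients of path algebras by quadratic monomial relations *)

Section QuadraticQuotient.

Variables (K : fieldType) (Q : quiver) (A : falgType K).
Variable f : {lrmorphism path_algebra K Q -> A}.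
Hypothesis f_surj : forall y, exists x, f x = y.
Variable R : arrow Q -> arrow Q -> Prop.
Hypothesis R_comp : forall b a, R b a -> source b = target a.
Hypothesis f_ker : forall x, f x = 0 <->
  ideal_gen (fun y => exists b a, R b a /\ y = arr K b * arr K a) x.

(** For arrows that do not compose, the product in the path algebra is already
    zero, so this also says that b follows a. *)
Definition nonrel (a b : arrow Q) := f (arr K b * arr K a) != 0.
Local Notation good p := (sorted nonrel (parrows p)).

Lemma pbasis_mul (q p : qpath Q) :
  pbasis K q * pbasis K p = pbasis_opt K (Defs.pcomp q p).
Proof. exact: path_mul_basis. Qed.

Lemma arr_mul (b a : arrow Q) : target a = source b ->
  exists2 p, psource p = source a /\ parrows p = [:: a; b] &
    arr K b * arr K a = pbasis K p.
Proof.
move=> ab.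
have [p hp] : exists p, Defs.pcomp (arrow_path b) (arrow_path a) = Some p.
  exact: pcomp_ex.
exists p; last by rewrite /arr pbasis_mul hp.
by case/pcomp_someP: hp => _ vp; rewrite /psource /parrows vp.
Qed.

Lemma arr_mul0 (b a : arrow Q) : target a <> source b -> arr K b * arr K a = 0.
Proof. by move=> ab; rewrite /arr pbasis_mul pcomp_none. Qed.

Lemma nonrel_comp a b : nonrel a b -> target a = source b.
Proof.
move=> ab; apply/eqP; apply: contraNT ab => /eqP ab.
by rewrite /nonrel arr_mul0 // linear0 eqxx.
Qed.

Lemma f_bad (p : qpath Q) : ~~ good p -> f (pbasis K p) = 0.
Proof.
case/not_sorted => s1 [a [b [s2 [ep]]]] /negPn/eqP fab.
have w := valP p; rewrite -/(parrows p) -/(psource p) ep is_walk_cat /= in w.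
case/and4P: w => w1 /eqP sa /eqP sb w2.
pose p1 := QPath (w1 : is_walk (psource p, s1).1 (psource p, s1).2).
pose p2 := QPath (w2 : is_walk (target b, s2).1 (target b, s2).2).
have [q [sq aq] eq] := arr_mul (esym sb).
have [t ht] : exists t, Defs.pcomp q p1 = Some t by apply: pcomp_ex; rewrite sq.
have hp : Defs.pcomp p2 t = Some p.
  case: (pcomp_st ht) => st tt; apply/pcomp_someP; rewrite st tt; split.
    by rewrite /ptarget sq aq.
  apply/eqP; rewrite -pair_eqE /=; apply/andP; split; first by [].
  case/pcomp_someP: ht => _; rewrite /parrows => -> /=.
  by rewrite -/(parrows p) ep -/(parrows q) aq -catA.
have -> : pbasis K p = pbasis K p2 * (arr K b * arr K a * pbasis K p1).
  by rewrite eq pbasis_mul ht /= pbasis_mul hp.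
by rewrite rmorphM rmorphM -[X in _ * (X * _)]/(f _) fab mul0r mulr0.
Qed.

(** A description of the kernel of f by coefficients: the span of the paths
    that contain a relation. *)
Definition bad_span (x : path_algebra K Q) := forall p, good p -> pcoef p x = 0.

Lemma bad_spanD c x y : bad_span x -> bad_span y -> bad_span (c *: x + y).
Proof. by move=> hx hy p gp; rewrite linearP /= hx // hy // mulr0 addr0. Qed.

Lemma bad_span0 : bad_span 0.
Proof. by move=> p _; rewrite linear0. Qed.

Lemma bad_span_sum x : bad_span x ->
  forall P : path_algebra K Q -> Prop, P 0 ->
  (forall c x y, P x -> P y -> P (c *: x + y)) ->
  (forall p, ~~ good p -> P (pbasis K p)) -> P x.
Proof.
move=> hx P P0 PD Pb; rewrite (path_algebraE x) big_seq_cond.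
elim/big_rec: _ => // p y; rewrite andbT psuppP => np; apply: PD.
by apply: Pb; apply: contraNN np => /hx ->.
Qed.

Lemma bad_span_basis p : ~~ good p -> bad_span (pbasis K p).
Proof.
move=> np q gq; rewrite pcoef_basis; case: eqP gq => [<-|//].
by rewrite (negbTE np).
Qed.

Lemma bad_comp q p r : Defs.pcomp q p = Some r ->
  (~~ good p) || (~~ good q) -> ~~ good r.
Proof.
case/pcomp_someP=> _ vr; rewrite -negb_and; apply: contraNN.
by rewrite {1}/parrows vr /= => /cat_sorted2[-> ->].
Qed.

Lemma bad_span_ideal : two_sided_ideal bad_span.
Proof.
split=> [|x y hx hy|c x hx|c x hx].
- exact: bad_span0.
- by rewrite -[x]scale1r; exact: bad_spanD.
- apply: (bad_span_sum hx (P := fun x => bad_span (c * x)))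
    => [|a y z hy hz|p np].
  + by rewrite mulr0; exact: bad_span0.
  + by rewrite mulrDr -scalerAr; exact: bad_spanD.
  elim/path_algebra_ind: c => [|a y z hy hz|q].
  + by rewrite mul0r; exact: bad_span0.
  + by rewrite mulrDl -scalerAl; exact: bad_spanD.
  rewrite pbasis_mul; case E: Defs.pcomp => [r|] /=; last exact: bad_span0.
  by apply: bad_span_basis; apply: (bad_comp E); rewrite np.
apply: (bad_span_sum hx (P := fun x => bad_span (x * c)))
  => [|a y z hy hz|p np].
- by rewrite mul0r; exact: bad_span0.
- by rewrite mulrDl -scalerAl; exact: bad_spanD.
elim/path_algebra_ind: c => [|a y z hy hz|q].
- by rewrite mulr0; exact: bad_span0.
- by rewrite mulrDr -scalerAr; exact: bad_spanD.
rewrite pbasis_mul; case E: Defs.pcomp => [r|] /=; last exact: bad_span0.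
by apply: bad_span_basis; apply: (bad_comp E); rewrite np orbT.
Qed.

Lemma f_ker_bad x : f x = 0 -> bad_span x.
Proof.
move/f_ker => h; apply: h; first exact: bad_span_ideal.
move=> y [b [a [Rba ->]]].
have [p [sp ap] ep] := arr_mul (esym (R_comp Rba)); rewrite ep.
apply: bad_span_basis; rewrite ap /= andbT negbK; apply/eqP/f_ker.
by move=> I _ hI; apply: hI; exists b, a.
Qed.

(** The initial subpaths of p are linearly independent in A. *)
Lemma good_bounded p : good p -> (size (parrows p) <= \dim {:A})%N.
Proof.
move=> gp; set n := size (parrows p).
have w i : is_walk (psource p, take i (parrows p)).1
                   (psource p, take i (parrows p)).2.
  have := valP p; rewrite -/(parrows p) -/(psource p).
  by rewrite -{1}(cat_take_drop i (parrows p)) is_walk_cat => /andP[].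
pose q (i : 'I_n.+1) := QPath (w i).
have gq i : good (q i) by rewrite /parrows /=; apply: take_sorted.
have qI : injective q.
  move=> i j /(congr1 (fun p => size (parrows p))).
  rewrite /parrows /= !size_take; have := ltn_ord i; have := ltn_ord j.
  rewrite !ltnS -/n -/(parrows p) -/n => hj hi e.
  apply: val_inj => /=; move: e; rewrite -!/(minn _ _).
  by rewrite (minn_idPl hi) (minn_idPl hj).
pose X := [tuple f (pbasis K (q i)) | i < n.+1].
have Xi (i : 'I_n.+1) : X`_i = f (pbasis K (q i)).
  by rewrite -tnth_nth tnth_mktuple.
have fX : free X.
  apply/freeP => k; have -> : \sum_(i < n.+1) k i *: X`_i =
      f (\sum_i k i *: pbasis K (q i)).
    rewrite linear_sum /=; by apply: eq_bigr => i _; rewrite linearZ Xi.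
  move/f_ker_bad => h i; have := h _ (gq i).
  rewrite linear_sum /= (bigD1 i) //= linearZ /= pcoef_basis eqxx mulr1.
  rewrite big1 ?addr0 // => j ji; rewrite linearZ /= pcoef_basis.
  by rewrite (inj_eq qI) (negbTE ji) mulr0.
have := dimvS (subvf <<X>>%VS).
by move: fX; rewrite /free size_tuple => /eqP -> /ltnW.
Qed.

Lemma good_enum : exists L : seq (qpath Q), forall p, (p \in L) = good p.
Proof.
pose N := \dim {:A}.
pose F (u : vertex Q * N.-bseq (arrow Q)) : option (qpath Q) :=
  insub (u.1, val u.2).
exists [seq p <- pmap F (enum {: vertex Q * N.-bseq (arrow Q)}) | good p] => p.
rewrite mem_filter; case gp: (good p) => //=.
have b := good_bounded gp.
rewrite mem_pmap; apply/mapP.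
exists (psource p, Bseq b); first by rewrite mem_enum.
rewrite /F /=; symmetry; apply/eqP.
have -> : (psource p, parrows p) = val p.
  by rewrite /psource /parrows -surjective_pairing.
by rewrite valK.
Qed.

Variable L : seq (qpath Q).
Hypothesis LP : forall p, (p \in L) = good p.
Local Notation X := (seq_sub L).

(** Coordinates on A are read off from any preimage in the path algebra: those
    on relation-free paths do not depend on the choice ([pcoef_ker]). *)
Definition preimage_of (y : A) := projT1 (cid (f_surj y)).
Lemma preimage_ofK y : f (preimage_of y) = y.
Proof. exact: projT2 (cid (f_surj y)). Qed.

Definition path_el (x : X) : A := f (pbasis K (val x)).
Definition path_co (x : X) (a : A) : K := pcoef (val x) (preimage_of a).

Lemma pcoef_ker (x : X) u v : f u = f v -> pcoef (val x) u = pcoef (val x) v.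
Proof.
move=> uv; apply/eqP; rewrite -subr_eq0 -linearB /=; apply/eqP.
apply: f_ker_bad; first by rewrite linearB /= uv subrr.
by rewrite -LP; exact: valP x.
Qed.

Fact path_co_linear x : linear_for *%R (path_co x).
Proof.
move=> c a b; rewrite /path_co -linearP; apply: pcoef_ker.
by rewrite linearP /= !preimage_ofK.
Qed.

Fact path_co_el x y : path_co x (path_el y) = (x == y)%:R.
Proof.
rewrite /path_co (@pcoef_ker _ _ (pbasis K (val y))) ?preimage_ofK //.
by rewrite pcoef_basis eq_sym.
Qed.

Fact path_span a : a = \sum_x path_co x a *: path_el x.
Proof.
rewrite -[LHS]preimage_ofK /path_co.
elim/path_algebra_ind: (preimage_of a) => [|c x y hx hy|p].
- by rewrite linear0 big1 // => x _; rewrite linear0 scale0r.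
- rewrite linearP /= hx hy scaler_sumr -big_split /=; apply: eq_bigr => z _.
  by rewrite linearP /= scalerDl scalerA.
have [gp|np] := boolP (p \in L).
  rewrite (bigD1 (SeqSub gp)) //= pcoef_basis eqxx scale1r.
  rewrite big1 ?addr0 // => x nx.
  rewrite pcoef_basis; case: eqP => [e|_]; last by rewrite scale0r.
  by case/eqP: nx; apply: val_inj.
rewrite f_bad -?LP // big1 // => x _; rewrite pcoef_basis.
case: eqP => [e|_]; last by rewrite scale0r.
by case/negP: np; rewrite e; exact: valP x.
Qed.

Fact path_el_mul x y : path_el x * path_el y = oapp path_el 0 (path_mu x y).
Proof.
rewrite /path_el /path_mu -rmorphM pbasis_mul.
case: Defs.pcomp => [p|] /=; last exact: linear0.
case: insubP => [u _ <- //|]; rewrite LP; exact: f_bad.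
Qed.

Definition path_mult_basis : mult_basis A (@path_mu Q L) :=
  MultBasis path_co_linear path_co_el path_span path_el_mul.

End QuadraticQuotient.

(** * Isomorphisms read off from multiplication tables *)

Section BasisMap.

Variables (K : fieldType) (C C' : algType K) (X : finType).
Variables (mu : X -> X -> option X).
Variables (B : mult_basis C mu) (B' : mult_basis C' mu).

Definition basis_map (c : C) : C' := \sum_x co B x c *: el B' x.

Fact basis_map_linear : linear basis_map.
Proof.
move=> a c c'; rewrite scaler_sumr -big_split; apply: eq_bigr => x _.
by rewrite linearP scalerDl scalerA.
Qed.

HB.instance Definition _ :=
  GRing.isLinear.Build K C C' _ basis_map basis_map_linear.

Lemma basis_map_el x : basis_map (el B x) = el B' x.
Proof.
rewrite /basis_map (bigD1 x) //= co_el eqxx scale1r big1 ?addr0 // => y ny.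
by rewrite co_el (negbTE ny) scale0r.
Qed.

Lemma basis_map_mul c c' : basis_map (c * c') = basis_map c * basis_map c'.
Proof.
rewrite (el_span B c) (el_span B c') mulr_suml !linear_sum mulr_suml.
apply: eq_bigr => x _; rewrite mulr_sumr linear_sum mulr_sumr.
apply: eq_bigr => y _; rewrite -scalerAl -scalerAr !linearZ /=.
rewrite -scalerAl -scalerAr !basis_map_el !el_mul; congr (_ *: (_ *: _)).
by case: (mu x y) => [z|] /=; rewrite ?basis_map_el ?linear0.
Qed.

End BasisMap.

Lemma basis_mapK (K : fieldType) (C C' : algType K) (X : finType) mu
  (B : @mult_basis K C X mu)
  (B' : mult_basis C' mu) : cancel (basis_map B B') (basis_map B' B).
Proof.
move=> c; rewrite [basis_map B B' c]/basis_map linear_sum [RHS](el_span B).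
by apply: eq_bigr => x _; rewrite linearZ /= basis_map_el.
Qed.

Section AlgIso.

Variables (K : fieldType).

Section Map.
Variables (C C' : algType K) (X : finType).
Variables (mu : X -> X -> option X).
Variables (B : mult_basis C mu) (B' : mult_basis C' mu).

Fact basis_map_monoid : monoid_morphism (basis_map B B').
Proof.
split; last exact: basis_map_mul.
rewrite -[LHS]mulr1 -[X in _ * X](basis_mapK B' B) -basis_map_mul.
by rewrite mul1r basis_mapK.
Qed.

HB.instance Definition _ :=
  GRing.isMonoidMorphism.Build C C' (basis_map B B') basis_map_monoid.

Lemma alg_iso_basis : alg_iso C C'.
Proof.
exists (basis_map B B' : {lrmorphism C -> C'}).
by exists (basis_map B' B); exact: basis_mapK.
Qed.

End Map.

Lemma mult_basis_iso (C C' : algType K) (X : finType) mu :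
  alg_iso C C' -> @mult_basis K C' X mu -> inhabited (@mult_basis K C X mu).
Proof.
case=> f [g fK gK] B; constructor.
apply: (@MultBasis K C X mu (fun x => g (el B x))
  (fun x c => co B x (f c))) => [x a c c'|x y|c|x y].
- by rewrite !linearP.
- by rewrite gK co_el.
- apply: (can_inj fK); rewrite {1}(el_span B (f c)) linear_sum.
  by apply: eq_bigr => x _; rewrite linearZ /= gK.
apply: (can_inj fK); rewrite rmorphM /= !gK el_mul.
by case: (mu x y) => [z|] /=; rewrite ?gK ?linear0.
Qed.

Lemma mult_basis_reindex (C : algType K) (X Y : finType) mu nu (h : Y -> X) :
  bijective h -> (forall x y, mu (h x) (h y) = omap h (nu x y)) ->
  @mult_basis K C X mu -> @mult_basis K C Y nu.
Proof.
move=> bh hm B.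
apply: (@MultBasis K C Y nu (fun x => el B (h x)) (fun x => co B (h x)))
  => [x|x y|c|x y].
- exact: co_linear.
- by rewrite co_el (bij_eq bh).
- by rewrite [LHS](el_span B) (reindex h) //; exact: onW_bij.
by rewrite el_mul hm; case: (nu x y).
Qed.

End AlgIso.

(** The algebra with radical square zero on two vertices and two arrows, the
    arrow false going from the vertex false to the vertex true.  The arrow true
    is parallel to it for o = false (the Kronecker quiver) and goes back for
    o = true (an oriented 2-cycle). *)
Definition two_arrow_src (o c : bool) := o && c.
Definition two_arrow_tgt (o c : bool) := ~~ (o && c).
Definition two_arrow_mu o (x y : bool + bool) : option (bool + bool) :=
  match x, y with
  | inl u, inl v => if u == v then Some (inl u) else None
  | inl u, inr c => if u == two_arrow_tgt o c then Some (inr c) else None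
  | inr c, inl v => if v == two_arrow_src o c then Some (inr c) else None
  | inr _, inr _ => None
  end.
Definition two_arrow_ldiv o (p q : bool + bool) : option (bool + bool) :=
  match p, q with
  | inl v, inl u => if u == v then Some (inl v) else None
  | inl v, inr c => if v == two_arrow_src o c then Some (inr c) else None
  | inr _, inl _ => None
  | inr c, inr c' => if c == c' then Some (inl (two_arrow_tgt o c)) else None
  end.
Definition two_arrow_rdiv o (q p : bool + bool) : option (bool + bool) :=
  match p, q with
  | inl v, inl u => if u == v then Some (inl v) else None
  | inl v, inr c => if v == two_arrow_tgt o c then Some (inr c) else None
  | inr _, inl _ => None
  | inr c, inr c' => if c == c' then Some (inl (two_arrow_src o c)) else None
  end.

Lemma two_arrow_ldivP o p q r :
  two_arrow_ldiv o p q = Some r <-> two_arrow_mu o r p = Some q.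
Proof. by case: o p q r => [] [[]|[]] [[]|[]] [[]|[]]. Qed.

Lemma two_arrow_rdivP o p q r :
  two_arrow_rdiv o q p = Some r <-> two_arrow_mu o p r = Some q.
Proof. by case: o p q r => [] [[]|[]] [[]|[]] [[]|[]]. Qed.

Definition two_arrow_trivext_mu o :=
  trivext_mu (two_arrow_mu o) (two_arrow_ldiv o) (two_arrow_rdiv o).

(** Exchanges the arrow true with its dual.  The dual of an arrow runs in the
    opposite direction, so this turns the oriented 2-cycle into two parallel
    arrows. *)
Definition swap_dual (x : (bool + bool) + (bool + bool)) :=
  match x with
  | inl (inr true) => inr (inr true)
  | inr (inr true) => inl (inr true)
  | _ => x
  end.

Lemma swap_dualK : involutive swap_dual.
Proof. by case=> [[[]|[]]|[[]|[]]]. Qed.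

Lemma two_arrow_trivext_swap x y :
  two_arrow_trivext_mu true (swap_dual x) (swap_dual y) =
  omap swap_dual (two_arrow_trivext_mu false x y).
Proof. by case: x y => [[[]|[]]|[[]|[]]] [[[]|[]]|[[]|[]]]. Qed.

(** * Gentle algebras with two isolated arrows on the same ends *)

Section Gentle.

Variables (K : fieldType) (Q : quiver) (A : falgType K).
Variable f : {lrmorphism path_algebra K Q -> A}.
Variable I : path_algebra K Q -> Prop.
Hypothesis f_ker : forall x, f x = 0 <-> I x.
Hypothesis gI : gentle_ideal I.

Lemma nonrel_notin a b : nonrel f a b -> ~ I (arr K b * arr K a).
Proof. by move=> ab /f_ker/eqP; apply/negP. Qed.

Lemma nonrel_next a b c : nonrel f a b -> nonrel f a c -> b = c.
Proof.
move=> ab ac; apply: (gentle_nonrel_after gI (esym (nonrel_comp ab)) _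
  (esym (nonrel_comp ac))); exact: nonrel_notin.
Qed.

Lemma nonrel_prev a b c : nonrel f b a -> nonrel f c a -> b = c.
Proof.
move=> ab ac; apply: (gentle_nonrel_before gI (esym (nonrel_comp ab)) _
  (esym (nonrel_comp ac))); exact: nonrel_notin.
Qed.

Lemma rel_next a b c : source b = target a -> source c = target a ->
  f (arr K b * arr K a) = 0 -> f (arr K c * arr K a) = 0 -> b = c.
Proof.
by move=> sb sc /f_ker hb /f_ker hc; exact: (gentle_rel_after gI sb hb sc hc).
Qed.

Lemma rel_prev a b c : source a = target b -> source a = target c ->
  f (arr K a * arr K b) = 0 -> f (arr K a * arr K c) = 0 -> b = c.
Proof.
by move=> sb sc /f_ker hb /f_ker hc; exact: (gentle_rel_before gI sb hb sc hc).
Qed.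

Lemma card_le2 (T : finType) (D : {set T}) a b c : (#|D| <= 2)%N ->
  a \in D -> b \in D -> c \in D -> a != b -> c = a \/ c = b.
Proof.
move=> D2 aD bD cD ab; have [->|ca] := eqVneq c a; first by left.
right; apply/eqP; apply/negPn/negP => cb.
have : (#|[set a; b; c]| <= 2)%N.
  apply: leq_trans D2; apply: subset_leq_card; apply/subsetP => x.
  by rewrite !inE => /orP[/orP[]|] /eqP->.
by rewrite setUC cardsU1 !inE (negbTE ca) (negbTE cb) /= cards2 ab.
Qed.

Variable L : seq (qpath Q).
Hypothesis LP : forall p, (p \in L) = sorted (nonrel f) (parrows p).
Local Notation X := (seq_sub L).

Definition gentle_table := path_table LP (@nonrel_comp K Q A f).
Local Notation T := gentle_table.

Lemma gentle_string : string_table T.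
Proof. exact: path_table_string nonrel_next nonrel_prev. Qed.

(** A non-zero product with c would be a longer path containing x. *)
Lemma maximal_rel (x : X) a : arrs_of x = [:: a] -> maximal T x ->
  forall c, f (arr K a * arr K c) = 0 /\ f (arr K c * arr K a) = 0.
Proof.
move=> xa mx c.
have [y [sy ay]] :=
  ex_path LP (is_walk_arrow c) (isT : sorted (nonrel f) [:: c]).
have sx : psrc x = source a by have := arrs_walk x; rewrite xa => /walk_source.
have ly : (0 < rk T y)%N by rewrite /= /plen ay.
have [yx xy] := maximalP _ _ mx y ly.
split; apply/eqP/negPn/negP => h.
  have [||z ez] := @path_mu_ex _ _ _ LP x y; rewrite ?ay ?xa /= ?andbT //.
    by rewrite ptgtE sy ay /= sx (nonrel_comp h).
  by move: xy; rewrite /= ez.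
have [||z ez] := @path_mu_ex _ _ _ LP y x; rewrite ?ay ?xa /= ?andbT //.
  by rewrite ptgtE sx xa /= sy (nonrel_comp h).
by move: yx; rewrite /= ez.
Qed.

Section Exceptional.

Hypothesis Q_conn : quiver_connected Q.
Variables (o : bool) (x y : X).
Hypothesis gx : gen T x.
Hypothesis gy : gen T y.
Hypothesis xNy : x != y.
Hypothesis mx : maximal T x.
Hypothesis my : maximal T y.
Hypothesis ysrc : src T y = if o then tgt T x else src T x.
Hypothesis ytgt : tgt T y = if o then src T x else tgt T x.

(** Isolated arrows are in relation with every arrow that they meet.  So an
    arrow other than a and b at one of these vertices would be a third one with
    the same source or target, or would make some arrow have two relations on
    one side. *)
Lemma exceptional_arrows : exists a b : arrow Q,
  [/\ arrs_of x = [:: a], arrs_of y = [:: b], source a != target a,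
      (source b = if o then target a else source a) /\
      (target b = if o then source a else target a) &
      forall c, (source c == source a) || (source c == target a) ||
                (target c == source a) || (target c == target a) ->
        c = a \/ c = b].
Proof.
have /parrowP[a [xa sx]] := gx; have /parrowP[b [yb sy]] := gy.
have tx : tgt T x = target a by rewrite /= ptgtE xa.
have ty : tgt T y = target b by rewrite /= ptgtE yb.
have ab : a != b.
  apply: contra_neq xNy => ab.
  by apply: seq_sub_path_eq; rewrite ?sx ?sy ?xa ?yb ab.
have ra := maximal_rel xa mx; have rb := maximal_rel yb my.
move: ysrc ytgt; rewrite tx ty /= sx sy => sb tb.
have [ra1 ra2] : (forall c, f (arr K a * arr K c) = 0) /\
                   (forall c, f (arr K c * arr K a) = 0).
  by split=> c; case: (ra c).
have [rb1 rb2] : (forall c, f (arr K b * arr K c) = 0) /\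
                   (forall c, f (arr K c * arr K b) = 0).
  by split=> c; case: (rb c).
exists a, b; case: o sb tb => sb tb; split=> //.
- apply: contra_neq ab => st.
  by apply: (rel_next (a := a)); rewrite ?st ?sb.
- move=> c /orP[/orP[/orP[]|]|] /eqP e.
  + by left; apply: (rel_next (a := b)); rewrite ?tb.
  + by right; apply: (rel_next (a := a)); rewrite ?sb.
  + by right; apply: (rel_prev (a := a)); rewrite ?tb.
  by left; apply: (rel_prev (a := b)); rewrite ?sb.
- apply: contra_neq ab => st.
  by apply: (rel_prev (a := a)); rewrite ?st ?tb.
move=> c /orP[/orP[/orP[]|]|] /eqP e.
- by apply: (card_le2 (gentle_out gI (source a))); rewrite ?inE ?sb ?e.
- case/eqP: ab; apply: (rel_prev (a := c)); rewrite ?e ?tb //.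
- case/eqP: ab; apply: (rel_next (a := c)); rewrite ?e ?sb //.
by apply: (card_le2 (gentle_in gI (target a))); rewrite ?inE ?tb ?e.
Qed.

Definition exceptional_path (z : bool + bool) : X :=
  match z with
  | inl false => vx T (src T x)
  | inl true => vx T (tgt T x)
  | inr false => x
  | inr true => y
  end.

Lemma exceptional_path_inj : src T x <> tgt T x -> injective exceptional_path.
Proof.
move=> st; have rx : rk T x = 1%N by apply/eqP.
have ry : rk T y = 1%N by apply/eqP.
have vN v z : rk T z = 1%N -> vx T v <> z.
  by move=> rz /(congr1 (rk T)); rewrite rk_vx rz.
have xy : x <> y by apply/eqP.
have vI u v : vx T u = vx T v -> u = v.
  by move/(congr1 (src T)); rewrite !src_vx.
move=> [[]|[]] [[]|[]] //; rewrite /exceptional_path => e; exfalso;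
  by [apply: xy | apply: (vN _ _ rx e) | apply: (vN _ _ ry e)
     | apply: (vN _ _ rx (esym e)) | apply: (vN _ _ ry (esym e))
     | apply: st; apply: vI].
Qed.

(** By [exceptional_arrows] and connectedness, the vertices and arrows are
    those of the two-arrow quiver, and isolated arrows do not compose. *)
Lemma exceptional_basis :
  mult_basis A (mul T) -> inhabited (mult_basis A (two_arrow_mu o)).
Proof.
have [a [b [xa yb sta [sb tb] only]]] := exceptional_arrows.
have sx : src T x = source a by have := arrs_walk x; rewrite xa => /walk_source.
have tx : tgt T x = target a by rewrite /= ptgtE [psrc x]sx xa.
have st : src T x <> tgt T x by rewrite sx tx; apply/eqP.
have stb c : c = a \/ c = b ->
    (source c == source a) || (source c == target a) /\
    (target c == source a) || (target c == target a).
  by case=> ->; rewrite ?sb ?tb; case: (o); rewrite ?eqxx ?orbT.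
have vert v : (v == source a) || (v == target a).
  case/connectP: (Q_conn (source a) v) => p.
  elim/last_ind: p v => [v _ ->|p u IH v].
    by rewrite eqxx.
  rewrite rcons_path last_rcons => /andP[pp /existsP[c hc]] ->.
  have hu := IH _ pp erefl.
  have /stb[h1 h2] : c = a \/ c = b.
    apply: only; case/orP: hc => /andP[/eqP e1 /eqP e2]; rewrite ?e1 ?e2.
      by rewrite hu.
    by rewrite -!orbA orbA; apply/orP; right.
  by case/orP: hc => /andP[/eqP e1 /eqP e2]; [rewrite -e2 | rewrite -e1].
have all_ab c : c = a \/ c = b by apply: only; rewrite vert.
have inj := exceptional_path_inj st.
have onto z : exists u, exceptional_path u = z.
  case: (posnP (rk T z)) => [r0|rz].
    rewrite (rk0_vx r0); case/orP: (vert (src T z)) => /eqP ->.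
      by exists (inl false); rewrite /exceptional_path sx.
    by exists (inl true); rewrite /exceptional_path tx.
  have so := arrs_sorted LP z; move: (rz); rewrite /= /plen.
  case ez: (arrs_of z) so => [|c [|d s]] // so _.
    case: (all_ab c) => ec; [exists (inr false)|exists (inr true)];
      by apply: arrs_inj; rewrite /plen /= ?xa ?yb ?ez ?ec.
  case/andP: so; rewrite /nonrel.
  by case: (all_ab c) => ->;
    [rewrite (maximal_rel xa mx d).2 | rewrite (maximal_rel yb my d).2];
    rewrite eqxx.
have [g gK] := choice onto.
have bij : bijective exceptional_path.
  by exists g => // u; apply: inj; rewrite gK.
move=> B; constructor; apply: (mult_basis_reindex bij) B.
have rx : (0 < rk T x)%N by exact: gen_rk.
have ry : (0 < rk T y)%N by exact: gen_rk.
have [[xx _] [xy yx] [yy _]] := And3 (maximalP _ _ mx x rx)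
  (maximalP _ _ mx y ry) (maximalP _ _ my y ry).
have stF : (src T x == tgt T x) = false by apply/eqP.
have tsF : (tgt T x == src T x) = false by rewrite eq_sym.
move=> [u|c] [v|d].
- case: u v => [] []; rewrite /exceptional_path mul_vx src_vx;
    by rewrite ?eqxx ?stF ?tsF.
- rewrite /exceptional_path; case: u d => [] []; rewrite vx_mul ?ytgt;
    by case: (o); rewrite /= ?eqxx ?stF ?tsF.
- rewrite /exceptional_path; case: c v => [] []; rewrite mul_vx ?ysrc;
    by case: (o); rewrite /= ?eqxx ?stF ?tsF.
by case: c d => [] [].
Qed.

End Exceptional.
End Gentle.

(** * sl2-triples of outer derivations *)

(** With H = [E, F] these are the relations of sl2. *)
Definition has_sl2 (K : fieldType) (C : falgType K) : Prop :=
  exists E F : der C, [/\ lie (lie E F) E = 2%:R *: E,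
    lie (lie E F) F = - 2%:R *: F & E \notin @inner K C].

Section Sl2.

Variables (K : fieldType).
Hypothesis two_neq0 : 2%:R != 0 :> K.

Lemma lie_derived1 (L : lieAlgType K) n c (x y z : L) : lie_derived n y ->
  lie_derived n z -> x = c *: lie y z -> lie_derived n.+1 x.
Proof.
move=> hy hz ->; exists 1%N, (fun=> c), (fun=> y), (fun=> z); split=> //.
by rewrite big_ord1.
Qed.

(** E, F and H are multiples of brackets of one another, so all of them stay in
    every derived algebra. *)
Lemma sl2_not_solvable (C : falgType K) : has_sl2 C -> ~ lie_solvable (HH1 C).
Proof.
case=> E [F [hE hF]] /negP nE [n hn].
have : lie_derived n (hh1_class E).
  suff [] : [/\ lie_derived n (hh1_class E), lie_derived n (hh1_class F) &
    lie_derived n (hh1_class (lie E F))] by [].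
  elim: n {hn} => [//|n [dE dF dH]]; split.
  - apply: (lie_derived1 (c := 2%:R^-1) dH dE).
    by rewrite -hh1_classL hE linearZ scalerA mulVf // scale1r.
  - apply: (lie_derived1 (c := - 2%:R^-1) dH dF).
    by rewrite -hh1_classL hF linearZ scalerA mulrNN mulVf // scale1r.
  by apply: (lie_derived1 (c := 1) dE dF); rewrite scale1r hh1_classL.
move/hn => e0; apply: nE; rewrite -[E]subr0; apply/hh1_classP.
by rewrite e0 linear0.
Qed.

Section Conjugation.

Variables (C C' : falgType K) (f : {lrmorphism C -> C'}) (g : C' -> C).
Hypotheses (fK : cancel f g) (gK : cancel g f).

Let g_linear : linear g.
Proof. by move=> a x y; apply: (can_inj fK); rewrite linearP /= !gK. Qed.
Let g_mul x y : g (x * y) = g x * g y.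
Proof. by apply: (can_inj fK); rewrite rmorphM /= !gK. Qed.

Definition conj_fun (d : der C') (x : C) : C := g (d (f x)).
Fact conj_fun_linear d : linear (conj_fun d).
Proof. by move=> a x y; rewrite /conj_fun !linearP /= g_linear. Qed.
HB.instance Definition _ d :=
  GRing.isLinear.Build K C C _ (conj_fun d) (conj_fun_linear d).

Fact conj_derivation d : linfun (conj_fun d) \in @derivation K C.
Proof.
apply/derivationP => x y; rewrite !lfunE /= /conj_fun rmorphM derM.
have gD u v : g (u + v) = g u + g v by have := g_linear 1 u v; rewrite !scale1r.
by rewrite gD !g_mul !fK.
Qed.

Definition der_conj d : der C := Der (conj_derivation d).

Lemma der_conjE d x : der_conj d x = g (d (f x)).
Proof. by rewrite /= lfunE. Qed.

Lemma der_conj_lie (d e : der C') :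
  der_conj (lie d e) = lie (der_conj d) (der_conj e).
Proof.
apply: der_eqP => x; apply: (can_inj fK).
rewrite der_conjE gK.
have -> : lie d e (f x) = d (e (f x)) - e (d (f x)) := lieE d e (f x).
have -> : lie (der_conj d) (der_conj e) x = _ :=
  lieE (der_conj d) (der_conj e) x.
by rewrite linearB /= !der_conjE !gK.
Qed.

Lemma der_conj_scale c (d : der C') : der_conj (c *: d) = c *: der_conj d.
Proof.
apply: der_eqP => x; apply: (can_inj fK).
have sE (D : falgType K) (h : der D) t : (c *: h) t = c *: h t.
  by rewrite -[c *: h]addr0 der_lin zero_lfunE addr0.
by rewrite der_conjE !sE linearZ /= der_conjE !gK.
Qed.

Lemma der_conj_inner d : der_conj d \in @inner K C -> d \in @inner K C'.
Proof.
case/innerP=> a ha; apply/innerP; exists (f a) => x.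
apply: (can_inj gK); have := ha (g x); rewrite der_conjE gK => ->.
by apply: (can_inj fK); rewrite gK linearB /= !rmorphM /= gK.
Qed.

Lemma has_sl2_conj : has_sl2 C' -> has_sl2 C.
Proof.
case=> E [F [hE hF nE]]; exists (der_conj E), (der_conj F); split.
- by rewrite -!der_conj_lie hE der_conj_scale.
- by rewrite -!der_conj_lie hF der_conj_scale.
by apply: contra nE; exact: der_conj_inner.
Qed.

End Conjugation.

Lemma has_sl2_iso (C C' : falgType K) : alg_iso C C' -> has_sl2 C' -> has_sl2 C.
Proof. by case=> f [g fK gK]; exact: has_sl2_conj fK gK. Qed.

Section TrivextDerivation.

Variable A : falgType K.

(** A derivation acts on the dual bimodule by minus its transpose. *)
Definition trivext_der_fun (d : der A) (x : trivext A) : trivext A :=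
  (d x.1, - (x.2 \o val d)%VF).

Fact trivext_der_fun_linear d : linear (trivext_der_fun d).
Proof.
move=> a [x p] [y q]; congr (_, _); first by rewrite /= linearP.
apply/lfunP => u; rewrite /= opp_lfunE comp_lfunE add_lfunE scale_lfunE.
rewrite add_lfunE scale_lfunE !opp_lfunE !comp_lfunE.
by rewrite scalerN opprD.
Qed.
HB.instance Definition _ d :=
  GRing.isLinear.Build K (trivext A) (trivext A) _ (trivext_der_fun d)
    (trivext_der_fun_linear d).

Fact trivext_derivation d :
  linfun (trivext_der_fun d) \in @derivation K (trivext A).
Proof.
apply/derivationP => -[x p] [y q]; rewrite !lfunE.
congr (_, _); first by rewrite /= derM.
apply/lfunP => u; rewrite /=.
rewrite !(opp_lfunE, comp_lfunE, add_lfunE, dual_lactE, dual_ractE) /=.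
rewrite !lfunE /= !derM !linearD /=.
rewrite [RHS](AC ((1*2)*(2*1)) ((4*3)*((1*5)*(2*6)))) /=.
by rewrite subrr addNr !addr0.
Qed.

Definition der_trivext d : der (trivext A) := Der (trivext_derivation d).

Lemma der_trivextE d x : der_trivext d x = (d x.1, - (x.2 \o val d)%VF).
Proof. by rewrite /= lfunE. Qed.

Lemma der_trivext_lie (d e : der A) :
  der_trivext (lie d e) = lie (der_trivext d) (der_trivext e).
Proof.
apply: der_eqP => -[x p].
have -> : lie (der_trivext d) (der_trivext e) (x, p) = _ :=
  lieE (der_trivext d) (der_trivext e) (x, p).
rewrite !der_trivextE /=; congr (_, _); first exact: lieE.
apply/lfunP => u.
rewrite add_lfunE !opp_lfunE !comp_lfunE !opp_lfunE !comp_lfunE.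
have -> : val (lie d e) u = _ := lieE d e u.
by rewrite linearB !opprK opprB.
Qed.

Lemma der_scaleE (D : falgType K) c (h : der D) t : (c *: h) t = c *: h t.
Proof. by rewrite -[c *: h]addr0 der_lin zero_lfunE addr0. Qed.

Lemma der_trivext_scale c (d : der A) :
  der_trivext (c *: d) = c *: der_trivext d.
Proof.
apply: der_eqP => -[x p]; rewrite der_scaleE !der_trivextE.
congr (_, _); first exact: der_scaleE.
apply/lfunP => u; rewrite scale_lfunE !opp_lfunE !comp_lfunE.
have -> : val (c *: d) u = _ := der_scaleE c d u.
by rewrite linearZ /= scalerN.
Qed.

Lemma der_trivext_inner d :
  der_trivext d \in @inner K (trivext A) -> d \in @inner K A.
Proof.
case/innerP => -[a p] ha; apply/innerP; exists a => x.
by have := congr1 fst (ha (x, 0)); rewrite der_trivextE.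
Qed.

Lemma has_sl2_trivext : has_sl2 A -> has_sl2 (trivext A).
Proof.
case=> E [F [hE hF nE]]; exists (der_trivext E), (der_trivext F); split.
- by rewrite -!der_trivext_lie hE der_trivext_scale.
- by rewrite -!der_trivext_lie hF der_trivext_scale.
by apply: contra nE; exact: der_trivext_inner.
Qed.

End TrivextDerivation.

Section ParallelSl2.

Variables (C : falgType K) (B : mult_basis C (two_arrow_mu false)).

(** The derivation of the algebra of two parallel arrows that sends the arrow c
    to the other one: an elementary matrix acting on the span of
    the arrows. *)
Definition arrow_map (c : bool) (a : C) : C :=
  co B (inr c) a *: el B (inr (~~ c)).

Fact arrow_map_linear c : linear (arrow_map c).
Proof. by move=> a x y; rewrite /arrow_map linearP /= scalerDl scalerA. Qed.
HB.instance Definition _ c :=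
  GRing.isLinear.Build K C C _ (arrow_map c) (arrow_map_linear c).

Lemma co_arrow_mul c x y : co B (inr c) (x * y) =
  co B (inl true) x * co B (inr c) y + co B (inr c) x * co B (inl false) y.
Proof.
rewrite [x in x * _](el_span B) mulr_suml linear_sum big_sumType /=.
rewrite !big_bool /=.
have S (P : pred (bool + bool)) (F : bool + bool -> K) : \sum_(z | P z) F z =
    (if P (inl true) then F (inl true) else 0) +
    (if P (inl false) then F (inl false) else 0) +
    ((if P (inr true) then F (inr true) else 0) +
    (if P (inr false) then F (inr false) else 0)).
  by rewrite big_mkcond big_sumType /= !big_bool.
rewrite -!scalerAl !linearZ /= !co_lmul !S.
by case: c; rewrite /= !(mulr0, addr0, add0r).
Qed.

Lemma mul_arrow c y : el B (inr c) * y = co B (inl false) y *: el B (inr c).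
Proof.
rewrite [y in LHS](el_span B) mulr_sumr big_sumType /= !big_bool /=.
by rewrite -!scalerAr !el_mul /= !scaler0 !addr0 add0r.
Qed.

Lemma arrow_mul c x : x * el B (inr c) = co B (inl true) x *: el B (inr c).
Proof.
rewrite [x in LHS](el_span B) mulr_suml big_sumType /= !big_bool /=.
by rewrite -!scalerAl !el_mul /= !scaler0 !addr0.
Qed.

Fact arrow_derivation c : linfun (arrow_map c) \in @derivation K C.
Proof.
apply/derivationP => x y; rewrite !lfunE /= /arrow_map co_arrow_mul.
rewrite scalerDl -scalerAl -scalerAr mul_arrow arrow_mul !scalerA addrC.
by rewrite [co B (inr c) y * _]mulrC.
Qed.

Definition arrow_der c : der C := Der (arrow_derivation c).

Lemma arrow_derE c x : arrow_der c x = co B (inr c) x *: el B (inr (~~ c)).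
Proof. by rewrite /= lfunE. Qed.

Lemma arrow_der_lieE c x : lie (arrow_der c) (arrow_der (~~ c)) x =
  co B (inr (~~ c)) x *: el B (inr (~~ c)) - co B (inr c) x *: el B (inr c).
Proof.
have -> : lie (arrow_der c) (arrow_der (~~ c)) x = _ := lieE _ _ x.
by rewrite !arrow_derE !linearZ /= !co_el negbK !eqxx !mulr1.
Qed.

Lemma has_sl2_parallel : has_sl2 C.
Proof.
pose E := arrow_der false; pose F := arrow_der true.
have HE x : lie E F x = co B (inr true) x *: el B (inr true) -
   co B (inr false) x *: el B (inr false) by exact: (arrow_der_lieE false).
exists E, F; split.
- apply: der_eqP => x; rewrite der_scaleE.
  have -> : lie (lie E F) E x = _ := lieE (lie E F) E x.
  rewrite !HE !arrow_derE /= !linearB !linearZ /= !co_el /=.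
  rewrite !(mulr0, mulr1, scale0r, subr0, sub0r).
  by rewrite addr0 scaleNr scalerN opprK -scalerDr scaler_nat mulr2n.
- apply: der_eqP => x; rewrite der_scaleE.
  have -> : lie (lie E F) F x = _ := lieE (lie E F) F x.
  rewrite !HE !arrow_derE /= !linearB !linearZ /= !co_el /=.
  rewrite !(mulr0, mulr1, scale0r, subr0, sub0r).
  by rewrite add0r scaleNr scaler_nat mulr2n opprD scalerDr.
apply/negP => /innerP[a ha].
have := congr1 (co B (inr true)) (ha (el B (inr false))).
rewrite arrow_derE linearZ linearB /= !co_el /= arrow_mul mul_arrow.
rewrite !linearZ /= !co_el /=.
by rewrite !mulr0 subrr mulr1 => /eqP; rewrite oner_eq0.
Qed.

End ParallelSl2.
End Sl2.

Section KroneckerBasis.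

Variable K : fieldType.

Definition kpath (x : bool + bool) : qpath kronecker_quiver :=
  match x with
  | inl v => @trivial_path kronecker_quiver v
  | inr c => @arrow_path kronecker_quiver c
  end.

Lemma kpath_onto p : exists x, p = kpath x.
Proof.
case: p => [[v [|a [|b s]]] w].
- by exists (inl v); apply: val_inj.
- by exists (inr a); apply: val_inj; case/andP: (w) => /eqP /= <-.
by case/and3P: (w) => _ /=.
Qed.

Lemma kpath_inj : injective kpath.
Proof. by move=> [u|c] [v|d] /(congr1 val) //= -[->]. Qed.

Definition kronecker_basis : mult_basis (kronecker K) (two_arrow_mu false).
Proof.
apply: (@MultBasis K (kronecker K) _ (two_arrow_mu false)
  (fun x => pbasis K (kpath x)) (fun x c => pcoef (kpath x) c)) => [x|x y|c|x y].
- exact: pcoef_linear.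
- by rewrite pcoef_basis (inj_eq kpath_inj) eq_sym.
- apply: pcoefP => p; have [x ->] := kpath_onto p.
  rewrite linear_sum (bigD1 x) //= linearZ /= pcoef_basis eqxx mulr1.
  rewrite big1 ?addr0 // => y ny.
  by rewrite linearZ /= pcoef_basis (inj_eq kpath_inj) (negbTE ny) mulr0.
rewrite -[LHS]/(path_mul _ _) path_mul_basis; case: x y => [u|c] [v|d] /=.
- by rewrite pcomp_id_l /ptarget /=; case: eqP => [->|].
- by rewrite pcomp_id_l /ptarget /=; case: eqP.
- by rewrite pcomp_id_r /psource /=; case: eqP.
by [].
Defined.

End KroneckerBasis.

(** * Gentle algebras and their trivial extensions *)

Definition kronecker_trivext_basis (K : fieldType) (A : falgType K) o
    (B : mult_basis A (two_arrow_mu o)) :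
    mult_basis (trivext A) (two_arrow_trivext_mu false) :=
  (if o as o return mult_basis (trivext A) (two_arrow_trivext_mu o) ->
                    mult_basis (trivext A) (two_arrow_trivext_mu false)
   then mult_basis_reindex (inv_bij swap_dualK) two_arrow_trivext_swap else id)
  (trivext_basis B (@two_arrow_ldivP o) (@two_arrow_rdivP o)).

Theorem theorem5p4 (K : fieldType) (A : falgType K)
    (hA : gentle A)
    (hA_K : ~ alg_iso A K^o)
    (hA_X2 : ~ is_quotient A (fun p : {poly K} => is_true ('X^2 %| p)))
    (hchar : 2%N \notin [pchar K]) :
  (lie_solvable (HH1 A) <-> ~ alg_iso A (kronecker K)) /\
  (forall B : falgType K,
     brauer_graph_algebra B -> alg_iso B (trivext A) ->
     (lie_solvable (HH1 B) <-> ~ alg_iso B (trivext (kronecker K)))).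
Proof.
have two_neq0 : 2%:R != 0 :> K.
  by apply: contra hchar => e; rewrite inE /= e.
have [Q [I [conn gI [f [f_surj f_ker]]]]] := hA.
have [R [R_comp I_gen]] := gentle_quadratic gI.
have f_ker_gen x : f x = 0 <-> ideal_gen
    (fun y => exists b a, R b a /\ y = arr K b * arr K a) x.
  by rewrite f_ker I_gen.
have [L LP] := good_enum R_comp f_ker_gen.
have B := path_mult_basis f_surj R_comp f_ker_gen LP.
pose T := gentle_table LP; have S : string_table T := gentle_string f_ker gI LP.
have sl2K := has_sl2_parallel (kronecker_basis K).
have exc := exceptional_basis f_ker gI conn.
split.
  split=> [sA /has_sl2_iso/(_ sl2K)|nK]; first by move/(sl2_not_solvable two_neq0).
  apply: (string_solvable S two_neq0 B) => a b ga gb ab ma mb [es et].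
  have [BK] := exc L LP false a b ga gb ab ma mb (esym es) (esym et) B.
  by apply: nK; exact: alg_iso_basis BK (kronecker_basis K).
move=> C _ isoC; split=> [sC /has_sl2_iso/(_ (has_sl2_trivext sl2K))|nK].
  by move/(sl2_not_solvable two_neq0).
have [CB] := mult_basis_iso isoC (trivext_basis B (ldivP T) (rdivP T)).
apply: (trivext_solvable S two_neq0 CB) => a b ga gb ab ma mb.
suff ex o : mult_basis A (two_arrow_mu o) -> False.
  case=> -[es et].
    have [BK] := exc L LP false a b ga gb ab ma mb (esym es) (esym et) B.
    exact: ex BK.
  have [BK] := exc L LP true a b ga gb ab ma mb (esym et) (esym es) B.
  exact: ex BK.
move=> BK; apply: nK.
have [CK] := mult_basis_iso isoC (kronecker_trivext_basis BK).
exact: alg_iso_basis CK (kronecker_trivext_basis (kronecker_basis K)).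
Qed.
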